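(* Let $E$ be a Henselian valued field and $D$ a tame central division algebra over $E$ such that $char(\bar E)$ does not divide $deg(D)$. Let $(\omega,d)$ be the factor set of $\Gamma_D/\Gamma_E$ in $\bar D$ associated to $GD$ as described in the context. If $K$ is a Kummer subfield of $D$, then there exist a cocycle $d'\in Z^2(\Gamma_K/\Gamma_E, KUM(\bar K/\bar E))_{sym}$ (for the trivial action of $\Gamma_K/\Gamma_E$ on $KUM(\bar K/\bar E)$) and a map $\omega':\Gamma_K/\Gamma_E\to Aut(\bar D)$ which satisfies $\omega'_{\bar\gamma}(a)=a$ for all $a\in\bar K$ and $\bar\gamma\in\Gamma_K/\Gamma_E$, such that: 1. $(\omega', i_*d')$ is a factor set of $\Gamma_K/\Gamma_E$ in $\bar D$ cohomologous to $res^{\Gamma_D/\Gamma_E}_{\Gamma_K/\Gamma_E}(\omega,d)$, and 2. $e_*([d'])=[\alpha_K]$.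
   Context: Valued objects. Division algebras are finite-dimensional; $D$ central over $E$ means its center is $E$; $deg(D)=\sqrt{[D:E]}$. The valuation of $E$ extends uniquely to $D$. $\bar D,\bar E$ are the residue division ring and residue field, $\Gamma_D,\Gamma_E$ the value groups. $\theta_D:\Gamma_D/\Gamma_E\to Gal(Z(\bar D)/\bar E)$ is the homomorphism induced by conjugation: the class of the value of $x\in D^*$ is sent to the automorphism induced by $x(\cdot)x^{-1}$. $D$ is tame if $[D:E]=[\bar D:\bar E](\Gamma_D:\Gamma_E)$, $Z(\bar D)/\bar E$ is separable, and $char(\bar E)$ does not divide $|\ker\theta_D|$. $GD=\bigoplus_{\gamma\in\Gamma_D}D_{\ge\gamma}/D_{>\gamma}$ is the associated graded ring, where $D_{\ge\gamma}$ (resp. $D_{>\gamma}$) is the set of elements of value $\ge\gamma$ (resp. $>\gamma$); $GE$, $GK$ are defined similarly. $GD$ is a graded division algebra with center $GE$, $(GD)_0=\bar D$, and its grade group is $\Gamma_D$. In a graded ring, $gr(x)$ denotes the degree of a nonzero homogeneous element $x$; all units of $GD$ are homogeneous. $R^*$ is the group of units of a ring $R$. Factor sets. Let $A$ be a central simple algebra over a field $L$ and $H$ a finite group acting on $L$ by automorphisms. For $c\in A^*$, $Inn(c)(a)=cac^{-1}$. A factor set of $H$ in $A$ is a pair of maps $\omega:H\to Aut(A)$ (ring automorphisms), $f:H\times H\to A^*$ with $\omega_\sigma|_L=\sigma$, $\omega_\sigma\omega_\tau=Inn(f(\sigma,\tau))\omega_{\sigma\tau}$, and $f(\sigma,\tau)f(\sigma\tau,\mu)=\omega_\sigma(f(\tau,\mu))f(\sigma,\tau\mu)$.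 Two factor sets $(\omega,f)$ and $(\omega',f')$ are cohomologous if there are $a_\sigma\in A^*$ $(\sigma\in H)$ with $\omega'_\sigma=Inn(a_\sigma)\omega_\sigma$ and $f'(\sigma,\tau)=a_\sigma\omega_\sigma(a_\tau)f(\sigma,\tau)a_{\sigma\tau}^{-1}$. Here $A=\bar D$, $L=Z(\bar D)$, and $\Gamma_D/\Gamma_E$ and its subgroups act on $Z(\bar D)$ via $\theta_D$. The factor set $(\omega,d)$. Let $H=\Gamma_D/\Gamma_E$ (a finite abelian group). Fix a basis $(\bar\delta_i=\delta_i+\Gamma_E)_{1\le i\le r}$ of $H$ (so $H$ is the direct sum of the cyclic groups generated by the $\bar\delta_i$), let $q_i$ be the order of $\bar\delta_i$, and let $I=\{(m_1,\dots,m_r)\in\mathbb N^r: 0\le m_i<q_i\}$. Fix $x_i\in (GE)^*$ with $gr(x_i)=q_i\delta_i$ and $z_i\in (GD)^*$ with $gr(z_i)=\delta_i$. For $\bar m\in I$ put $\bar m\bar\delta=\sum m_i\bar\delta_i$ and $z_{\bar m\bar\delta}=z^{\bar m}=z_1^{m_1}\cdots z_r^{m_r}$; every $\bar\gamma\in H$ is uniquely of the form $\bar m\bar\delta$. Let $\omega_{\bar\gamma}\in Aut(\bar D)$ be $a\mapsto z_{\bar\gamma}az_{\bar\gamma}^{-1}$. For $\bar m,\bar n\in I$ write $m_i+n_i=\beta_i+t_iq_i$ with $0\le\beta_i<q_i$, $t_i\in\mathbb N$; put $h(\bar m\bar\delta,\bar n\bar\delta)=\prod_i x_i^{t_i}\in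 (GE)^*$ and $d(\bar\gamma,\bar\gamma')=z_{\bar\gamma}z_{\bar\gamma'}z_{\bar\gamma+\bar\gamma'}^{-1}h(\bar\gamma,\bar\gamma')^{-1}\in\bar D^*$. The pair $(\omega,d)$ is a factor set of $H$ in $\bar D$; $res^{H}_{R}(\omega,d)$ denotes its restriction to a subgroup $R$ of $H$. Kummer data. A Kummer subfield $K$ of $D$ is a subfield containing $E$ with $K/E$ finite abelian Galois and $E$ containing a primitive $m$-th root of unity, $m$ the exponent of $Gal(K/E)$. For a Kummer field extension $M/k$ of exponent $m$: $KUM(M/k)=\{x\in M^*: x^m\in k\}$, $kum(M/k)=KUM(M/k)/k^*$. Likewise $GK$ is a Kummer graded field extension of $GE$: with $m$ the exponent of $Gal(GK/GE)$, $KUM(GK/GE)=\{x\in (GK)^*: x^m\in GE\}$ and $kum(GK/GE)=KUM(GK/GE)/(GE)^*$. There is an exact sequence of trivial $\Gamma_K/\Gamma_E$-modules $$1\to kum(\bar K/\bar E)\stackrel{\phi}{\to}kum(GK/GE)\stackrel{\psi}{\to}\Gamma_K/\Gamma_E\to 0,$$ with $\phi(a\bar E^* )=a(GE)^*$, $\psi(a(GE)^* )=gr(a)+\Gamma_E$; $\alpha_K\in Z^2(\Gamma_K/\Gamma_E,kum(\bar K/\bar E))_{sym}$ denotes a 2-cocycle representing this abelian group extension and $[\alpha_K]$ its class. The subscript $sym$ denotes symmetric 2-cocycles (resp. classes of these). $e:KUM(\bar K/\bar E)\to kum(\bar K/\bar E)$ is the canonical surjection and $e_*:H^2(\Gamma_K/\Gamma_E,KUM(\bar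 K/\bar E))_{sym}\to H^2(\Gamma_K/\Gamma_E,kum(\bar K/\bar E))_{sym}$ the induced map (trivial actions). $i:KUM(\bar K/\bar E)\to\bar D^*$ is the inclusion and $i_*d'=i\circ d'$. *)

(* Defs.v *)
From HB Require Import structures.
From mathcomp Require Import all_boot all_order all_algebra all_fingroup.
From mathcomp Require Import all_solvable all_field ring_quotient finmap.
From mathcomp Require Import generic_quotient.
From mathcomp Require Import boolp classical_sets functions cardinality fsbigop.

Set Implicit Arguments.
Unset Strict Implicit.
Unset Printing Implicit Defensive.

Import Order.TTheory GRing.Theory.

Local Open Scope classical_set_scope.
Local Open Scope quotient_scope.
Local Open Scope ring_scope.

Notation "{ 'quot' I }" := (Quotient.quot I) : type_scope.

HB.mixin Record POrderedZmodule_isTotallyOrdered G of Num.POrderedZmodule G := {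
  oz_total : total (<=%O : rel G);
  oz_leD2r : forall z x y : G, x <= y -> x + z <= y + z
}.

#[short(type="orderedZmodType")]
HB.structure Definition OrderedZmodule :=
  { G of Num.POrderedZmodule G & POrderedZmodule_isTotallyOrdered G }.

Section OrderedZmoduleTheory.
Variable G : orderedZmodType.
Implicit Types x y z t : G.

Lemma ole_min x y z : x <= y -> x <= z -> x <= Order.min y z.
Proof. by rewrite minElt; case: ifP. Qed.

Lemma olt_min x y z : x < y -> x < z -> x < Order.min y z.
Proof. by rewrite minElt; case: ifP. Qed.

Lemma oleD2r z x y : (x + z <= y + z) = (x <= y).
Proof.
apply/idP/idP => [h|]; last exact: oz_leD2r.
by rewrite -(addrK z x) -(addrK z y) oz_leD2r.
Qed.

Lemma oltD2r z x y : (x + z < y + z) = (x < y).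
Proof. by rewrite !lt_def oleD2r (inj_eq (addIr z)). Qed.

Lemma oleD2l z x y : (z + x <= z + y) = (x <= y).
Proof. by rewrite ![z + _]addrC oleD2r. Qed.

Lemma oltD2l z x y : (z + x < z + y) = (x < y).
Proof. by rewrite ![z + _]addrC oltD2r. Qed.

Lemma oleD x y z t : x <= y -> z <= t -> x + z <= y + t.
Proof. by move=> xy zt; apply: (le_trans (y := y + z)); rewrite ?oleD2r ?oleD2l. Qed.

Lemma oltleD x y z t : x < y -> z <= t -> x + z < y + t.
Proof. by move=> xy zt; apply: (lt_le_trans (y := y + z)); rewrite ?oltD2r ?oleD2l. Qed.

Lemma oleltD x y z t : x <= y -> z < t -> x + z < y + t.
Proof. by move=> xy zt; apply: (le_lt_trans (y := y + z)); rewrite ?oleD2r ?oltD2l. Qed.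

End OrderedZmoduleTheory.

(* Valuations are only meaningful on nonzero elements: the value at 0 is      *)
(* arbitrary and is ignored everywhere.                                       *)
Record valuation (G : orderedZmodType) (A : nzRingType) := Valuation {
  vfun :> A -> G;
  valM : forall x y, x != 0 -> y != 0 -> vfun (x * y) = vfun x + vfun y;
  valD : forall x y, x != 0 -> y != 0 -> x + y != 0 ->
           Order.min (vfun x) (vfun y) <= vfun (x + y)
}.

Section Filtration.
Variables (G : orderedZmodType) (A : nzRingType) (v : valuation G A).

Definition filt_ge (g : G) : {pred A} := [pred x | (x == 0) || (g <= v x)].
Definition filt_gt (g : G) : {pred A} := [pred x | (x == 0) || (g < v x)].

Lemma val1 : v 1 = 0.
Proof.
have := valM v (oner_neq0 A) (oner_neq0 A); rewrite mulr1 => /eqP.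
by rewrite -subr_eq subrr => /eqP.
Qed.

Lemma double_eq0 (x : G) : x + x = 0 -> x = 0.
Proof.
move=> xx; have : (x <= 0) || (0 <= x) := oz_total x 0.
case/orP=> h; apply/eqP; rewrite eq_le h ?andbT /=.
  by rewrite -(oleD2r x) add0r xx.
by rewrite -(oleD2r x) add0r xx.
Qed.

Lemma valN x : v (- x) = v x.
Proof.
have [->|x0] := eqVneq x 0; first by rewrite oppr0.
have N10 : (- 1 : A) != 0 by rewrite oppr_eq0 oner_neq0.
have vN1 : v (- 1) = 0.
  by apply: double_eq0; rewrite -valM// mulrNN mulr1 val1.
by rewrite -mulN1r valM// vN1 add0r.
Qed.

Lemma filt_ge_closed g : zmod_closed (filt_ge g).
Proof.
split=> [|x y]; first by rewrite !inE eqxx.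
rewrite !inE; have [->|x0] := eqVneq x 0.
  by rewrite sub0r oppr_eq0 valN.
have [->|y0] := eqVneq y 0; first by rewrite subr0 (negPf x0).
have [//|xy0] := eqVneq (x - y) 0; rewrite /= => gx gy.
have Ny0 : - y != 0 by rewrite oppr_eq0.
by apply: le_trans (valD v x0 Ny0 xy0); rewrite ole_min// valN.
Qed.

Lemma filt_gt_closed g : zmod_closed (filt_gt g).
Proof.
split=> [|x y]; first by rewrite !inE eqxx.
rewrite !inE; have [->|x0] := eqVneq x 0.
  by rewrite sub0r oppr_eq0 valN.
have [->|y0] := eqVneq y 0; first by rewrite subr0 (negPf x0).
have [//|xy0] := eqVneq (x - y) 0; rewrite /= => gx gy.
have Ny0 : - y != 0 by rewrite oppr_eq0.
by apply: lt_le_trans (valD v x0 Ny0 xy0); rewrite olt_min// valN.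
Qed.

HB.instance Definition _ g := GRing.isZmodClosed.Build A (filt_ge g) (filt_ge_closed g).
HB.instance Definition _ g := GRing.isZmodClosed.Build A (filt_gt g) (filt_gt_closed g).

Lemma filt_gtW g x : x \in filt_gt g -> x \in filt_ge g.
Proof. by rewrite !inE => /orP[->//|/ltW->]; rewrite orbT. Qed.

Lemma filt_geM g h x y : x \in filt_ge g -> y \in filt_ge h -> x * y \in filt_ge (g + h).
Proof.
rewrite !inE; have [->|x0] := eqVneq x 0; first by rewrite mul0r eqxx.
have [->|y0] := eqVneq y 0; first by rewrite mulr0 eqxx.
by rewrite /= valM// => gx gy; rewrite oleD ?orbT.
Qed.

Lemma filt_gt_geM g h x y : x \in filt_gt g -> y \in filt_ge h -> x * y \in filt_gt (g + h).
Proof.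
rewrite !inE; have [->|x0] := eqVneq x 0; first by rewrite mul0r eqxx.
have [->|y0] := eqVneq y 0; first by rewrite mulr0 eqxx.
by rewrite /= valM// => gx gy; rewrite oltleD ?orbT.
Qed.

Lemma filt_ge_gtM g h x y : x \in filt_ge g -> y \in filt_gt h -> x * y \in filt_gt (g + h).
Proof.
rewrite !inE; have [->|x0] := eqVneq x 0; first by rewrite mul0r eqxx.
have [->|y0] := eqVneq y 0; first by rewrite mulr0 eqxx.
by rewrite /= valM// => gx gy; rewrite oleltD ?orbT.
Qed.

Local Notation cls g x := (\pi_({quot (filt_gt g)}) x).

(* The degree g component A_{>= g} / A_{> g} is the subgroup of A / A_{> g}   *)
(* formed by the classes of the elements of A_{>= g}; an element of the       *)
(* associated graded ring is a finitely supported family of such classes.     *)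
Record gr := Gr {
  grcomp :> forall g : G, {quot (filt_gt g)};
  grcomp_ge : forall g, exists2 x, x \in filt_ge g & grcomp g = cls g x;
  grcomp_fin : finite_set [set g | grcomp g != 0]
}.

HB.instance Definition _ := gen_eqMixin gr.
HB.instance Definition _ := gen_choiceMixin gr.

Lemma gr_eqP (f h : gr) : (forall g, f g = h g) -> f = h.
Proof.
case: f h => [f f1 f2] [h h1 h2] /= fh.
have E : f = h by apply: functional_extensionality_dep.
by case: _ / E in h1 h2 *; congr Gr; apply: Prop_irrelevance.
Qed.

Lemma pi_gtE g (x y : A) : (cls g x = cls g y) <-> (x - y \in filt_gt g).
Proof. by rewrite Quotient.idealrBE; split=> [->|/eqP]. Qed.

(* Finitely supported lifts of an element of the graded ring to A *)
Definition lifts (F : G -> A) (s : seq G) (f : gr) :=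
  [/\ uniq s, forall g, g \notin s -> F g = 0, forall g, F g \in filt_ge g
    & forall g, f g = cls g (F g)].

Definition gr_lift (f : gr) (g : G) : A := if f g == 0 then 0 else repr (f g).
Definition gr_supp (f : gr) : seq G := fset_set [set g | f g != 0].

Lemma gr_liftP f : lifts (gr_lift f) (gr_supp f) f.
Proof.
rewrite /gr_lift /gr_supp; split=> [|g|g|g].
- exact: fset_uniq.
- rewrite in_fset_set; last exact: grcomp_fin.
  by rewrite notin_setE /= => /negP; rewrite negbK => ->.
- case: eqP => _; first exact: rpred0.
  have [x xg fx] := grcomp_ge f g.
  have /pi_gtE : cls g (repr (f g)) = cls g x by rewrite reprK fx.
  by move=> /filt_gtW h; rewrite -(subrK x (repr _)) rpredD.
- by case: eqP => [->|_]; rewrite ?reprK// raddf0.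
Qed.

Lemma mk_gr_ge (F : G -> A) (F_ge : forall g, F g \in filt_ge g) g :
  exists2 x, x \in filt_ge g & cls g (F g) = cls g x.
Proof. by exists (F g). Qed.

Lemma mk_gr_fin (F : G -> A) (s : seq G) (Fs : forall g, g \notin s -> F g = 0) :
  finite_set [set g | cls g (F g) != 0].
Proof.
apply: sub_finite_set (finite_seq s) => g /=.
by apply: contraNT => /Fs ->; rewrite raddf0.
Qed.

Lemma sum_cover (T : nmodType) (s t : seq G) (F : G -> T) : uniq s -> uniq t ->
  (forall g, g \notin s -> F g = 0) -> (forall g, g \notin t -> F g = 0) ->
  \sum_(g <- s) F g = \sum_(g <- t) F g.
Proof.
move=> us ut Fs Ft.
by rewrite (bigfs _ us (fun g _ => Fs g)) (bigfs _ ut (fun g _ => Ft g)).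
Qed.

Definition conv (s t : seq G) (F H : G -> A) (g : G) : A :=
  \sum_(a <- s) \sum_(b <- t | a + b == g) F a * H b.

Definition sumset (s t : seq G) : seq G := undup [seq a + b | a <- s, b <- t].

Lemma conv_off s t F H g : g \notin sumset s t -> conv s t F H g = 0.
Proof.
rewrite mem_undup => gst; rewrite /conv big1_seq// => a /= sa.
rewrite big1_seq// => b /= /andP[/eqP abg tb].
by case/negP: gst; rewrite -abg; apply/allpairsP; exists (a, b).
Qed.

Lemma conv_ge s t F H g : (forall a, F a \in filt_ge a) ->
  (forall a, H a \in filt_ge a) -> conv s t F H g \in filt_ge g.
Proof.
move=> Fge Hge; apply: rpred_sum => a _; apply: rpred_sum => b /eqP <-.
exact: filt_geM.
Qed.

Lemma conv_cover s s' t t' F H g : uniq s -> uniq s' -> uniq t -> uniq t' ->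
  (forall g, g \notin s -> F g = 0) -> (forall g, g \notin s' -> F g = 0) ->
  (forall g, g \notin t -> H g = 0) -> (forall g, g \notin t' -> H g = 0) ->
  conv s t F H g = conv s' t' F H g.
Proof.
move=> us us' ut ut' Fs Fs' Ht Ht'; rewrite /conv.
rewrite (sum_cover us us') => [|a /Fs Fa|a /Fs' Fa]; last 2 first.
- by rewrite big1// => b _; rewrite Fa mul0r.
- by rewrite big1// => b _; rewrite Fa mul0r.
apply: eq_bigr => a _; rewrite big_mkcond [RHS]big_mkcond /=.
apply: sum_cover => // b; [move=> /Ht Hb|move=> /Ht' Hb];
by rewrite Hb mulr0 if_same.
Qed.

Definition conv_gr s t F H (Fge : forall a, F a \in filt_ge a)
    (Hge : forall a, H a \in filt_ge a) : gr :=
  Gr (mk_gr_ge (fun g => conv_ge s t g Fge Hge))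
     (mk_gr_fin (fun g => @conv_off s t F H g)).

Definition lift_ge f : forall a, gr_lift f a \in filt_ge a :=
  let: And4 _ _ h _ := gr_liftP f in h.

Definition gr_mul (f h : gr) : gr :=
  conv_gr (gr_supp f) (gr_supp h) (lift_ge f) (lift_ge h).

Lemma gr_zeroP (g : G) : (0 : A) \in filt_ge g. Proof. exact: rpred0. Qed.
Definition gr_zero : gr :=
  Gr (mk_gr_ge gr_zeroP) (@mk_gr_fin (fun=> 0) [::] (fun _ _ => erefl)).

(* The homogeneous element of degree g given by the class of x; it is only    *)
(* meaningful for x in A_{>= g}, and is 0 otherwise.                          *)
Definition hom_fun (g : G) (x : A) (a : G) : A :=
  if (a == g) && (x \in filt_ge g) then x else 0.
Lemma hom_fun_ge g x a : hom_fun g x a \in filt_ge a.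
Proof. by rewrite /hom_fun; case: ifP => [/andP[/eqP->]|_]; rewrite ?rpred0. Qed.
Lemma hom_fun_off g x a : a \notin [:: g] -> hom_fun g x a = 0.
Proof. by rewrite inE /hom_fun => /negPf ->. Qed.
Definition hom (g : G) (x : A) : gr :=
  Gr (mk_gr_ge (hom_fun_ge g x)) (mk_gr_fin (@hom_fun_off g x)).

Lemma hom_lifts g x : lifts (hom_fun g x) [:: g] (hom g x).
Proof. split=> // a; [exact: hom_fun_off|exact: hom_fun_ge]. Qed.

Lemma gr_opp_ge (f : gr) g : - gr_lift f g \in filt_ge g.
Proof. by rewrite rpredN lift_ge. Qed.
Lemma gr_opp_off (f : gr) g : g \notin gr_supp f -> - gr_lift f g = 0.
Proof. by have [_ h _ _] := gr_liftP f => /h ->; rewrite oppr0. Qed.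
Definition gr_opp (f : gr) : gr :=
  Gr (mk_gr_ge (gr_opp_ge f)) (mk_gr_fin (@gr_opp_off f)).

Lemma gr_add_ge (f h : gr) g : gr_lift f g + gr_lift h g \in filt_ge g.
Proof. by rewrite rpredD ?lift_ge. Qed.
Lemma gr_add_off (f h : gr) g : g \notin undup (gr_supp f ++ gr_supp h) ->
  gr_lift f g + gr_lift h g = 0.
Proof.
have [_ Ff _ _] := gr_liftP f; have [_ Fh _ _] := gr_liftP h.
by rewrite mem_undup mem_cat negb_or => /andP[/Ff-> /Fh->]; rewrite addr0.
Qed.
Definition gr_add (f h : gr) : gr :=
  Gr (mk_gr_ge (gr_add_ge f h)) (mk_gr_fin (@gr_add_off f h)).

Lemma gr_addE f h g : gr_add f h g = f g + h g.
Proof.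
have [_ _ _ ->] := gr_liftP f; have [_ _ _ ->] := gr_liftP h.
by rewrite /= raddfD.
Qed.

Lemma gr_oppE f g : gr_opp f g = - f g.
Proof. by have [_ _ _ ->] := gr_liftP f; rewrite /= raddfN. Qed.

Lemma gr_zeroE g : gr_zero g = 0. Proof. by rewrite /= raddf0. Qed.

Lemma gr_addA : associative gr_add.
Proof. by move=> f h k; apply: gr_eqP => g; rewrite !gr_addE addrA. Qed.
Lemma gr_addC : commutative gr_add.
Proof. by move=> f h; apply: gr_eqP => g; rewrite !gr_addE addrC. Qed.
Lemma gr_add0 : left_id gr_zero gr_add.
Proof. by move=> f; apply: gr_eqP => g; rewrite !gr_addE gr_zeroE add0r. Qed.
Lemma gr_addN : left_inverse gr_zero gr_opp gr_add.
Proof. by move=> f; apply: gr_eqP => g; rewrite !gr_addE gr_oppE gr_zeroE addNr. Qed.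

HB.instance Definition _ := GRing.isZmodule.Build gr gr_addA gr_addC gr_add0 gr_addN.

Lemma grD (f h : gr) g : (f + h) g = f g + h g. Proof. exact: gr_addE. Qed.
Lemma grN (f : gr) g : (- f) g = - f g. Proof. exact: gr_oppE. Qed.
Lemma gr0 g : (0 : gr) g = 0. Proof. exact: gr_zeroE. Qed.

Lemma conv_congr s t s' t' F H F' H' f h g :
  lifts F s f -> lifts H t h -> lifts F' s' f -> lifts H' t' h ->
  cls g (conv s t F H g) = cls g (conv s' t' F' H' g).
Proof.
move=> [us Fs Fge Ff] [ut Ht Hge Hh] [us' Fs' Fge' Ff'] [ut' Ht' Hge' Hh'].
pose S := undup (s ++ s'); pose T := undup (t ++ t').
have [uS uT] : uniq S /\ uniq T by rewrite !undup_uniq.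
have FS a : a \notin S -> F a = 0 by rewrite mem_undup mem_cat negb_or => /andP[/Fs].
have FS' a : a \notin S -> F' a = 0 by rewrite mem_undup mem_cat negb_or => /andP[_ /Fs'].
have HT a : a \notin T -> H a = 0 by rewrite mem_undup mem_cat negb_or => /andP[/Ht].
have HT' a : a \notin T -> H' a = 0 by rewrite mem_undup mem_cat negb_or => /andP[_ /Ht'].
rewrite (@conv_cover s S t T)// (@conv_cover s' S t' T)//.
apply/pi_gtE; rewrite /conv -sumrB; apply: rpred_sum => a _.
rewrite -sumrB; apply: rpred_sum => b /eqP <-.
have -> : F a * H b - F' a * H' b = (F a - F' a) * H b + F' a * (H b - H' b).
  by rewrite mulrBl mulrBr addrA subrK.
apply: rpredD.
  by apply: filt_gt_geM => //; apply/pi_gtE; rewrite -Ff -Ff'.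
by apply: filt_ge_gtM => //; apply/pi_gtE; rewrite -Hh -Hh'.
Qed.

Lemma gr_mulE s t F H f h g : lifts F s f -> lifts H t h ->
  gr_mul f h g = cls g (conv s t F H g).
Proof. by move=> lf lh; apply: conv_congr lf lh => //; apply: gr_liftP. Qed.

Lemma gr_mul_lifts s t F H f h : lifts F s f -> lifts H t h ->
  lifts (conv s t F H) (sumset s t) (gr_mul f h).
Proof.
move=> lf lh; split=> [|g|g|g]; first exact: undup_uniq.
- exact: conv_off.
- by case: lf lh => [? ? ? ?] [? ? ? ?]; apply: conv_ge.
- exact: gr_mulE.
Qed.

Lemma gr_add_lifts s F H f h : lifts F s f -> lifts H s h ->
  lifts (F \+ H) s (f + h).
Proof.
move=> [us Fs Fge Ff] [_ Hs Hge Hh]; split=> // g.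
- by move=> gs; rewrite /= Fs// Hs// addr0.
- exact: rpredD.
- by rewrite grD Ff Hh raddfD.
Qed.

Lemma lifts_widen s t F f : uniq t -> {subset s <= t} -> lifts F s f -> lifts F t f.
Proof.
move=> ut st [us Fs Fge Ff]; split=> // g gt; apply: Fs.
by apply: contra gt; apply: st.
Qed.

Lemma sum_pick (s : seq G) (k : G) (F : G -> A) : uniq s -> k \in s ->
  \sum_(c <- s | c == k) F c = F k.
Proof. by move=> us ks; rewrite -big_filter filter_pred1_uniq// big_seq1. Qed.

Lemma convA s t u F H K g :
  conv (sumset s t) u (conv s t F H) K g = conv s (sumset t u) F (conv t u H K) g.
Proof.
have in_sumset (s' t' : seq G) a b : a \in s' -> b \in t' -> a + b \in sumset s' t'.
  by move=> sa tb; rewrite mem_undup; apply/allpairsP; exists (a, b).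
transitivity (\sum_(a <- s) \sum_(b <- t) \sum_(d <- u | a + b + d == g) F a * H b * K d).
  pose T a b c := \sum_(d <- u | c + d == g) F a * H b * K d.
  transitivity (\sum_(c <- sumset s t) \sum_(a <- s) \sum_(b <- t | c == a + b) T a b c).
    apply: eq_bigr => c _; rewrite /conv /T.
    under eq_bigr => d _ do rewrite mulr_suml.
    rewrite exchange_big /=; apply: eq_bigr => a _.
    under eq_bigr => d _ do rewrite mulr_suml.
    rewrite exchange_big /=; apply: eq_bigl => b; exact: eq_sym.
  rewrite exchange_big /=; apply: eq_big_seq => a sa.
  rewrite (exchange_big_dep predT)//=; apply: eq_big_seq => b tb.
  by rewrite sum_pick ?undup_uniq ?in_sumset.
apply: eq_big_seq => a sa.
pose T b c d : A := if a + c == g then F a * H b * K d else 0.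
transitivity (\sum_(c <- sumset t u) \sum_(b <- t) \sum_(d <- u | c == b + d) T b c d).
  rewrite exchange_big /=; apply: eq_big_seq => b tb.
  rewrite (exchange_big_dep predT)//= big_mkcond; apply: eq_big_seq => d ud.
  by rewrite sum_pick ?undup_uniq ?in_sumset// /T addrA.
rewrite [RHS]big_mkcond; apply: eq_bigr => c _; rewrite /T.
case: ifP => _; last by rewrite big1// => b _; rewrite big1.
rewrite mulr_sumr; apply: eq_bigr => b _.
rewrite mulr_sumr; apply: eq_big => [d|d _]; [exact: eq_sym|exact/esym/mulrA].
Qed.

Lemma gr_mulA : associative (@gr_mul).
Proof.
move=> f h k; apply: gr_eqP => g.
have lf := gr_liftP f; have lh := gr_liftP h; have lk := gr_liftP k.
rewrite (gr_mulE _ lf (gr_mul_lifts lh lk)) (gr_mulE _ (gr_mul_lifts lf lh) lk).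
by rewrite convA.
Qed.

Lemma conv1l s F g : uniq s -> (forall g, g \notin s -> F g = 0) ->
  conv [:: 0] s (hom_fun 0 1) F g = F g.
Proof.
move=> us Fs; rewrite /conv big_seq1 /hom_fun eqxx /= inE val1 lexx orbT.
under eq_bigl do rewrite add0r. under eq_bigr do rewrite mul1r.
have [gs|gs] := boolP (g \in s); first by rewrite sum_pick.
by rewrite Fs// big1_seq// => b /= /andP[/eqP->]; rewrite (negPf gs).
Qed.

Lemma conv1r s F g : uniq s -> (forall g, g \notin s -> F g = 0) ->
  conv s [:: 0] F (hom_fun 0 1) g = F g.
Proof.
move=> us Fs; rewrite /conv.
under eq_bigr do rewrite big_mkcond big_seq1 addr0 /hom_fun eqxx /= inE val1 lexx orbT mulr1.
rewrite -big_mkcond /=.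
have [gs|gs] := boolP (g \in s); first by rewrite sum_pick.
by rewrite Fs// big1_seq// => b /= /andP[/eqP->]; rewrite (negPf gs).
Qed.

Lemma gr_mul1l : left_id (hom 0 1) gr_mul.
Proof.
move=> f; apply: gr_eqP => g; have lf := gr_liftP f.
rewrite (gr_mulE _ (hom_lifts 0 1) lf).
by case: lf => us Fs _ ->; rewrite conv1l.
Qed.

Lemma gr_mul1r : right_id (hom 0 1) gr_mul.
Proof.
move=> f; apply: gr_eqP => g; have lf := gr_liftP f.
rewrite (gr_mulE _ lf (hom_lifts 0 1)).
by case: lf => us Fs _ ->; rewrite conv1r.
Qed.

Lemma lifts_common f h : exists s F H, lifts F s f /\ lifts H s h.
Proof.
exists (undup (gr_supp f ++ gr_supp h)), (gr_lift f), (gr_lift h).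
split; apply: lifts_widen (gr_liftP _); rewrite ?undup_uniq// => a;
by rewrite mem_undup mem_cat => ->; rewrite ?orbT.
Qed.

Lemma gr_mulDl : left_distributive gr_mul +%R.
Proof.
move=> f h k; apply: gr_eqP => g; have lk := gr_liftP k.
have [s [F [H [lf lh]]]] := lifts_common f h.
rewrite grD (gr_mulE _ lf lk) (gr_mulE _ lh lk) (gr_mulE _ (gr_add_lifts lf lh) lk).
rewrite -raddfD /conv -big_split /=; congr (cls g _); apply: eq_bigr => a _.
by rewrite -big_split /=; apply: eq_bigr => b _; rewrite mulrDl.
Qed.

Lemma gr_mulDr : right_distributive gr_mul +%R.
Proof.
move=> k f h; apply: gr_eqP => g; have lk := gr_liftP k.
have [s [F [H [lf lh]]]] := lifts_common f h.
rewrite grD (gr_mulE _ lk lf) (gr_mulE _ lk lh) (gr_mulE _ lk (gr_add_lifts lf lh)).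
rewrite -raddfD /conv -big_split /=; congr (cls g _); apply: eq_bigr => a _.
by rewrite -big_split /=; apply: eq_bigr => b _; rewrite mulrDr.
Qed.

Lemma gr_one_neq0 : hom 0 1 != 0 :> gr.
Proof.
apply/eqP => /(congr1 (fun f : gr => f 0)); rewrite gr0 /= /hom_fun eqxx inE val1 lexx orbT /=.
rewrite -(raddf0 (\pi_({quot (filt_gt 0)}))) => /pi_gtE.
by rewrite subr0 inE oner_eq0 val1 ltxx.
Qed.

HB.instance Definition _ := GRing.Zmodule_isNzRing.Build gr
  gr_mulA gr_mul1l gr_mul1r gr_mulDl gr_mulDr gr_one_neq0.

End Filtration.

Section ClassicalInverse.
Variable R : nzRingType.

Definition cunit : {pred R} := fun x => `[< exists y, y * x = 1 /\ x * y = 1 >].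
Definition cinv (x : R) : R := xget x [set y | y * x = 1 /\ x * y = 1].

Lemma cinvP x : x \in cunit -> cinv x * x = 1 /\ x * cinv x = 1.
Proof. by move/asboolP => h; apply: (xgetPex x h). Qed.
Lemma cmulVr : {in cunit, left_inverse 1 cinv *%R}.
Proof. by move=> x /cinvP[]. Qed.
Lemma cdivrr : {in cunit, right_inverse 1 cinv *%R}.
Proof. by move=> x /cinvP[]. Qed.
Lemma cunitP (x y : R) : y * x = 1 /\ x * y = 1 -> x \in cunit.
Proof. by move=> h; apply/asboolP; exists y. Qed.
Lemma cinv_out : {in [predC cunit], cinv =1 id}.
Proof.
move=> x; rewrite inE => /negP nx; rewrite /cinv; case: xgetP => // y _ h.
by case: nx; apply: cunitP h.
Qed.

End ClassicalInverse.

Section Graded.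
Variables (G : orderedZmodType) (A : nzRingType) (v : valuation G A).
Notation gr := (gr v).
Implicit Types f h : gr.

HB.instance Definition _ := GRing.NzRing_hasMulInverse.Build gr
  (@cmulVr gr) (@cdivrr gr) (@cunitP gr) (@cinv_out gr).

Lemma homE g x a : hom v g x a = \pi_({quot (filt_gt v a)}) (hom_fun v g x a).
Proof. by []. Qed.

Lemma homM (g h : G) x y : x \in filt_ge v g -> y \in filt_ge v h ->
  hom v g x * hom v h y = hom v (g + h) (x * y).
Proof.
move=> xg yh; apply: gr_eqP => a.
rewrite (gr_mulE _ (hom_lifts v g x) (hom_lifts v h y)) homE; congr \pi.
rewrite /conv big_seq1 big_mkcond big_seq1 /hom_fun !eqxx xg yh filt_geM// andbT /=.
by rewrite [a == _]eq_sym andbT.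
Qed.

Lemma hom1 : hom v 0 1 = 1. Proof. by []. Qed.

(* gr(f) = g for a nonzero homogeneous element f *)
Definition has_degree f (g : G) := f != 0 /\ forall a, a != g -> f a = 0.

Definition degree0 : {pred gr} := fun f => `[< forall a, a != 0 -> f a = 0 >].

Lemma degree0_homP f : f \in degree0 -> f = hom v 0 (gr_lift f 0).
Proof.
move/asboolP => f0; apply: gr_eqP => a; rewrite homE /hom_fun lift_ge andbT.
by case: eqP => [->|/eqP/f0 ->]; rewrite ?raddf0//; case: (gr_liftP f).
Qed.

Lemma hom_degree0 x : hom v 0 x \in degree0.
Proof. by apply/asboolP => a /negPf a0; rewrite homE /hom_fun a0 raddf0. Qed.

Lemma degree0_subring : subring_closed degree0.
Proof.
split=> [|f h /asboolP f0 /asboolP h0|f h f0 h0]; first exact: hom_degree0.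
- by apply/asboolP => a a0; rewrite grD grN f0// h0// subr0.
- rewrite (degree0_homP f0) (degree0_homP h0) homM ?lift_ge// addr0.
  exact: hom_degree0.
Qed.

HB.instance Definition _ := GRing.isSubringClosed.Build gr degree0 degree0_subring.

(* The residue ring of A, as the degree 0 component of the graded ring *)
Record residue := Residue { resval :> gr; resvalP : resval \in degree0 }.

HB.instance Definition _ := [isSub for resval].
HB.instance Definition _ := [Choice of residue by <:].
HB.instance Definition _ := [SubChoice_isSubNzRing of residue by <:].
HB.instance Definition _ := GRing.NzRing_hasMulInverse.Build residue
  (@cmulVr residue) (@cdivrr residue) (@cunitP residue) (@cinv_out residue).

(* Only meaningful for x in the valuation ring *)
Definition res (x : A) : residue := Residue (hom_degree0 x).
Definition res_lift (a : residue) : A := gr_lift (resval a) 0.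

Lemma res_liftK : cancel res_lift res.
Proof. by move=> a; apply: val_inj; rewrite /= -degree0_homP ?resvalP. Qed.

Lemma res_lift_ge a : res_lift a \in filt_ge v 0.
Proof. exact: lift_ge. Qed.

Lemma resM x y : x \in filt_ge v 0 -> y \in filt_ge v 0 -> res x * res y = res (x * y).
Proof. by move=> x0 y0; apply: val_inj; rewrite /= homM// addr0. Qed.

Lemma res_eq0 x : x \in filt_ge v 0 -> (res x == 0) = (x \in filt_gt v 0).
Proof.
move=> x0; rewrite -val_eqE /=; apply/eqP/idP => [/(congr1 (fun f : gr => f 0))|x1].
  rewrite gr0 homE /hom_fun eqxx x0 -(raddf0 (\pi_({quot (filt_gt v 0)}))).
  by move/pi_gtE; rewrite subr0.
apply: gr_eqP => a; rewrite gr0 homE /hom_fun x0 andbT.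
case: eqP => [->|]; rewrite ?raddf0// -(raddf0 (\pi_({quot (filt_gt v 0)}))).
by apply/pi_gtE; rewrite subr0.
Qed.

End Graded.

Section ResidueField.
Variables (G : orderedZmodType) (F : fieldType) (v : valuation G F).

Lemma residue_mulC : commutative (@GRing.mul (residue v)).
Proof.
move=> a b; rewrite -(res_liftK a) -(res_liftK b).
by rewrite !resM ?res_lift_ge// mulrC.
Qed.

HB.instance Definition _ :=
  GRing.PzSemiRing_hasCommutativeMul.Build (residue v) residue_mulC.

Lemma residue_unit (a : residue v) : a != 0 -> a \is a GRing.unit.
Proof.
have x0 := res_lift_ge a; rewrite -{1 2}(res_liftK a) res_eq0//.
set x := res_lift a in x0 *; rewrite inE negb_or => /andP[x1 vx].
have vx0 : v x = 0.
  move: x0; rewrite inE (negPf x1) /= le_eqVlt => /orP[/eqP->//|].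
  by rewrite (negPf vx).
have xV : x^-1 \in filt_ge v 0.
  rewrite inE; apply/orP; right; have /eqP := val1 v.
  by rewrite -(mulfV x1) valM ?invr_eq0// vx0 add0r => /eqP ->.
by apply/unitrP; exists (res v x^-1); rewrite !resM// mulVf// mulfV//; split; apply: val_inj.
Qed.

HB.instance Definition _ := GRing.ComUnitRing_isField.Build (residue v) residue_unit.

End ResidueField.

Section ValueGroup.
Variable G : orderedZmodType.

Definition value_group (A : nzRingType) (v : valuation G A) (S : set A) : set G :=
  [set g | exists x, [/\ S x, x != 0 & v x = g]].

Variables (F : fieldType) (v : valuation G F).

Definition field_value_group : {pred G} := fun g => `[< value_group v setT g >].

Lemma field_value_group_closed : zmod_closed field_value_group.
Proof.
split=> [|g h /asboolP[x [_ x0 <-]] /asboolP[y [_ y0 <-]]]; apply/asboolP.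
  by exists 1; rewrite oner_neq0 val1.
exists (x / y); split=> //; first by rewrite mulf_neq0 ?invr_eq0.
by apply/eqP; rewrite eq_sym subr_eq -valM ?divfK// mulf_neq0 ?invr_eq0.
Qed.

HB.instance Definition _ :=
  GRing.isZmodClosed.Build G field_value_group field_value_group_closed.

(* G is an ambient ordered group: Gamma_D / Gamma_F is a subgroup of G / Gamma_F. *)
Definition value_quot : zmodType := {quot field_value_group}.
Definition value_class (g : G) : value_quot := \pi_({quot field_value_group}) g.

(* Hensel's lemma: a simple root in the residue field of a monic polynomial   *)
(* over the valuation ring lifts to a root.                                   *)
Definition henselian : Prop :=
  forall (p : {poly F}) (a : F), p \is monic -> p \is a polyOver (filt_ge v 0) ->
    a \in filt_ge v 0 -> p.[a] \in filt_gt v 0 -> p^`().[a] \notin filt_gt v 0 ->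
  exists b, [/\ b \in filt_ge v 0, root p b & b - a \in filt_gt v 0].

End ValueGroup.

Definition ring_center (R : nzRingType) : set R := [set a | forall b, a * b = b * a].
Arguments ring_center : clear implicits.

Section Subrings.

Definition units_of (R : nzRingType) (T : set R) : set R :=
  [set x | T x /\ exists y, [/\ T y, x * y = 1 & y * x = 1]].

(* n is the dimension of R as a left vector space over its sub-division ring S *)
Definition has_dim (R : nzRingType) (S : set R) (n : nat) : Prop :=
  exists b : 'I_n -> R, forall x, exists! c : {ffun 'I_n -> R},
    (forall i, S (c i)) /\ x = \sum_i c i * b i.

Variables (G : orderedZmodType) (A : nzRingType) (v : valuation G A).

(* The residue ring and the graded ring of a subring S of A, inside those of A *)
Definition res_sub (S : set A) : set (residue v) :=
  [set a | exists x, [/\ S x, x \in filt_ge v 0 & a = res v x]].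

Definition gr_sub (S : set A) : set (gr v) :=
  [set f | forall g, exists x,
     [/\ S x, x \in filt_ge v g & f g = \pi_({quot (filt_gt v g)}) x]].

(* The degree 0 element f, seen in the residue ring (0 if f is not in degree 0) *)
Definition gr_res (f : gr v) : residue v := insubd 0 f.

End Subrings.
Arguments res_sub {G A} v S.
Arguments gr_sub {G A} v S.

Section FactorSets.
Variables (A : unitRingType) (H : zmodType).
Implicit Types (R : set H) (w : H -> A -> A) (f : H -> H -> A).

Definition ring_aut (s : A -> A) : Prop :=
  [/\ zmod_morphism s, monoid_morphism s & bijective s].

(* (w, f) restricted to the subgroup R of H is a factor set of R in A, where  *)
(* s in R acts on the center of A by act s; the values of w and f outside R   *)
(* are irrelevant.                                                            *)
Definition factor_set R (act : H -> A -> A) w f : Prop :=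
  [/\ forall s, R s -> ring_aut (w s),
      forall s t, R s -> R t -> f s t \is a GRing.unit,
      forall s a, R s -> ring_center A a -> w s a = act s a,
      forall s t a, R s -> R t -> w s (w t a) = f s t * w (s + t) a * (f s t)^-1
    & forall s t u, R s -> R t -> R u ->
        f s t * f (s + t) u = w s (f t u) * f s (t + u)].

Definition cohomologous R w f w' f' : Prop :=
  exists c : H -> A,
    [/\ forall s, R s -> c s \is a GRing.unit,
        forall s a, R s -> w' s a = c s * w s a * (c s)^-1
      & forall s t, R s -> R t -> f' s t = c s * w s (c t) * f s t * (c (s + t))^-1].

(* Symmetric 2-cocycles of R with values in M, for the trivial action *)
Definition sym_cocycle R (M : set A) f : Prop :=
  [/\ forall s t, R s -> R t -> M (f s t),
      forall s t, R s -> R t -> f s t = f t s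
    & forall s t u, R s -> R t -> R u -> f s t * f (s + t) u = f t u * f s (t + u)].

End FactorSets.

Section Kummer.
Variable R : nzRingType.
Implicit Types (S T : set R) (m : nat).

(* Automorphisms of T over its subring S; only the restriction to T matters *)
Definition rel_aut S T : set (R -> R) :=
  [set s | [/\ set_bij T T s,
               forall x y, T x -> T y -> s (x + y) = s x + s y,
               forall x y, T x -> T y -> s (x * y) = s x * s y
             & forall x, S x -> s x = x]].

(* Exponent of a group P of automorphisms of T (0 if there is none) *)
Definition aut_exponent T (P : set (R -> R)) : nat :=
  let kills m := forall s x, P s -> T x -> iter m s x = x in
  xget 0%N [set m | [/\ (0 < m)%N, kills m
                      & forall k, (0 < k)%N -> kills k -> (m <= k)%N]].

Definition KUM m S T : set R := [set x | units_of T x /\ S (x ^+ m)].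

(* Elements of quotients by S^* are represented by the cosets themselves *)
Definition set_mul (X Y : set R) : set R := [set x * y | x in X & y in Y].
Definition unit_coset S (x : R) : set R := set_mul [set x] (units_of S).
Definition kum m S T : set (set R) := [set unit_coset S x | x in KUM m S T].

End Kummer.

Definition kummer_ext (E : fieldType) (L : splittingFieldType E) : Prop :=
  [/\ galois 1%VS {:L}, abelian 'Gal({:L} / 1%VS)
    & exists z : E, (exponent 'Gal({:L} / 1%VS)).-primitive_root z].

Section ValuedAlgebra.
Variables (G : orderedZmodType) (E : fieldType) (vE : valuation G E).
Variables (D : falgType E) (vD : valuation G D).
Local Notation Q := (value_quot vE).

Definition base_field : set D := [set a%:A | a in [set: E]].

Definition rel_value_group (S : set D) : set Q :=
  [set value_class vE g | g in value_group vD S].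

(* theta_D: the class of v(x) acts on the residue ring by x (.) x^-1; on the  *)
(* center this does not depend on x.                                          *)
Definition theta (s : Q) (a : residue vD) : residue vD :=
  let x := xget 1 [set x | x != 0 /\ value_class vE (vD x) = s] in
  res vD (x * res_lift a * x^-1).

Definition theta_ker : set Q :=
  [set s | rel_value_group setT s /\ forall a, ring_center (residue vD) a -> theta s a = a].

Definition res_embed (a : residue vE) : residue vD := res vD (res_lift a)%:A.

Definition tame : Prop :=
  [/\ exists m e, [/\ has_dim (res_sub vD base_field) m,
                      (rel_value_group setT #= `I_e)%card & \dim {:D} = (m * e)%N],
      forall a, ring_center (residue vD) a ->
        exists2 p : {poly residue vE}, separable_poly p & root (map_poly res_embed p) a
    & exists2 k, (theta_ker #= `I_k)%card &
        forall p, p \in [pchar (residue vE)] -> ~~ (p %| k)%N].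

Section FactorSetOfGr.
Variables (r : nat) (delta : 'I_r -> G) (q : 'I_r -> nat).

(* The classes of the delta_i form a basis of Gamma_D / Gamma_E, and q_i is   *)
(* the order of the class of delta_i.                                         *)
Definition value_basis : Prop :=
  [/\ forall i, value_group vD setT (delta i),
      forall i, [/\ (0 < q i)%N, value_class vE (delta i) *+ q i = 0 &
        forall k, (0 < k < q i)%N -> value_class vE (delta i) *+ k != 0]
    & forall s, rel_value_group setT s ->
        exists! m : {ffun 'I_r -> nat},
          (forall i, (m i < q i)%N) /\ s = \sum_i value_class vE (delta i) *+ m i].

Definition coords (s : Q) : {ffun 'I_r -> nat} :=
  xget [ffun=> 0%N] [set m | (forall i, (m i < q i)%N) /\
                             s = \sum_i value_class vE (delta i) *+ m i].

Variables (x z : 'I_r -> gr vD).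

Definition fs_z (s : Q) : gr vD := \prod_i z i ^+ coords s i.

Definition fs_h (s t : Q) : gr vD :=
  \prod_i x i ^+ ((coords s i + coords t i) %/ q i).

Definition fs_omega (s : Q) (a : residue vD) : residue vD :=
  gr_res (fs_z s * resval a * (fs_z s)^-1).

Definition fs_d (s t : Q) : residue vD :=
  gr_res (fs_z s * fs_z t * (fs_z (s + t))^-1 * (fs_h s t)^-1).

End FactorSetOfGr.

Section KummerSubfield.
Variable K : set D.

Local Notation Ebar := (res_sub vD base_field).
Local Notation Kbar := (res_sub vD K).
Local Notation GE := (gr_sub vD base_field).
Local Notation GK := (gr_sub vD K).

Definition res_KUM : set (residue vD) :=
  KUM (aut_exponent Kbar (rel_aut Ebar Kbar)) Ebar Kbar.

Definition res_kum : set (set (residue vD)) :=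
  kum (aut_exponent Kbar (rel_aut Ebar Kbar)) Ebar Kbar.

Definition graded_aut : set (gr vD -> gr vD) :=
  [set s | rel_aut GE GK s /\
           forall f g, GK f -> has_degree f g -> has_degree (s f) g].

Definition gr_kum : set (set (gr vD)) :=
  kum (aut_exponent GK graded_aut) GE GK.

Definition kum_phi (X : set (residue vD)) : set (gr vD) :=
  set_mul [set resval a | a in X] (units_of GE).

Definition kum_psi (X : set (gr vD)) (s : Q) : Prop :=
  exists f g, [/\ X f, has_degree f g & value_class vE g = s].

(* alpha is the 2-cocycle of the extension                                    *)
(*   1 -> res_kum --kum_phi--> gr_kum --kum_psi--> Gamma_K / Gamma_E -> 0     *)
(* attached to some section u of kum_psi.                                     *)
Definition represents_kum_extension (alpha : Q -> Q -> set (residue vD)) : Prop :=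
  exists u : Q -> set (gr vD),
    [/\ forall s, rel_value_group K s -> gr_kum (u s) /\ kum_psi (u s) s,
        forall s t, rel_value_group K s -> rel_value_group K t -> res_kum (alpha s t)
      & forall s t, rel_value_group K s -> rel_value_group K t ->
          set_mul (u s) (u t) = set_mul (kum_phi (alpha s t)) (u (s + t))].

Definition kum_class (a : residue vD) : set (residue vD) := unit_coset Ebar a.

(* f and alpha differ by a coboundary, as 2-cocycles of Gamma_K / Gamma_E     *)
(* with values in kum(Kbar/Ebar)                                              *)
Definition kum_cohomologous (f alpha : Q -> Q -> set (residue vD)) : Prop :=
  exists b : Q -> set (residue vD),
    (forall s, rel_value_group K s -> res_kum (b s)) /\
    forall s t, rel_value_group K s -> rel_value_group K t ->
      set_mul (f s t) (b (s + t)) = set_mul (set_mul (b s) (b t)) (alpha s t).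

End KummerSubfield.

End ValuedAlgebra.

Arguments base_field {E} D _.
Arguments rel_value_group {G E} vE {D} vD S _.
Arguments theta {G E vE D vD} s a.
Arguments tame {G E} vE {D} vD.
Arguments value_basis {G E} vE {D} vD {r} delta q.
Arguments fs_omega {G E vE D vD r} delta q z s a.
Arguments fs_d {G E vE D vD r} delta q x z s t.
Arguments res_KUM {G E D} vD K _.
Arguments represents_kum_extension {G E} vE {D} vD K alpha.
Arguments kum_class {G E D vD} a _.
Arguments kum_cohomologous {G E} vE {D} vD K f alpha.

(* Main.v *)
Require Import Defs.
From HB Require Import structures.
From mathcomp Require Import all_boot all_order all_algebra all_fingroup.
From mathcomp Require Import all_solvable all_field.
From mathcomp Require Import boolp classical_sets.

Set Implicit Arguments.
Unset Strict Implicit.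
Unset Printing Implicit Defensive.

Import Order.TTheory GRing.Theory.

Local Open Scope classical_set_scope.
Local Open Scope ring_scope.

(** Write GD, GE, GK for the graded rings of D, E, K. The factor set
    (omega, d) records how the homogeneous units z_s of GD multiply: omega_s
    is conjugation by z_s, and z_s z_t = d(s,t) h(s,t) z_(s+t) with h(s,t) a
    central unit coming from GE. Any other family y_s of homogeneous units
    with the degrees of the z_s gives in the same way a factor set, and the
    elements c_s = y_s z_s^-1 of degree 0 show that the two are cohomologous
    ([system_factor_set], [system_cohomologous]).

    On the subgroup Gamma_K / Gamma_E the y_s can be taken in GK: the section
    u of kum(GK/GE) -> Gamma_K / Gamma_E behind the cocycle alpha provides
    cosets u(s) of GE^*, and in such a coset one can adjust a homogeneous
    element by a unit of GE so that it has the degree of z_s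
    ([kummer_system]). Let (omega', d') be the resulting factor set. As GK is
    commutative, omega'_s fixes the residue field of K and d' is symmetric;
    and once d' takes values in that field, the crossed cocycle identity for
    d' is the cocycle identity for the trivial action.

    It remains to compare d' with alpha. By construction d'(s,t) is the
    product of y_s y_t y_(s+t)^-1 and a unit of GE, whereas
    u(s) u(t) = phi(alpha(s,t)) u(s+t). Hence d'(s,t) lies in the coset
    alpha(s,t) up to a unit of GE of degree 0, that is, up to a unit of the
    residue field of E ([system_cocycle_kum]). So d' has values in KUM of the
    residue fields and its image in kum is alpha itself. *)

(** * Identities in a crossed product *)

(** Both sides come from expanding ys yt yu in two ways, where the product of
    two basis elements is a coefficient times a central carry times a basis
    element. *)
Lemma crossed_product_assoc (B : unitRingType) (ys yt yu yst ytu ystu : B)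
    (h1 h2 h3 h4 c1 c2 c3 c4 : B) :
    ys \is a GRing.unit -> ystu \is a GRing.unit -> h1 * h2 \is a GRing.unit ->
    (forall b, [/\ h1 * b = b * h1 & h3 * b = b * h3]) -> h1 * h2 = h3 * h4 ->
    ys * yt = c1 * h1 * yst -> yst * yu = c2 * h2 * ystu ->
    yt * yu = c3 * h3 * ytu -> ys * ytu = c4 * h4 * ystu ->
  c1 * c2 = ys * c3 * ys^-1 * c4.
Proof.
move=> su stuu hu hC hE E1 E2 E3 E4; apply: (mulIr hu); apply: (mulIr stuu).
have h1C b : h1 * b = b * h1 by case: (hC b).
have h3C b : h3 * b = b * h3 by case: (hC b).
transitivity (ys * yt * yu).
  by rewrite E1 -[RHS]mulrA E2 !mulrA -(mulrA c1 h1) h1C !mulrA.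
rewrite -mulrA E3 hE.
have -> : ys * (c3 * h3 * ytu) = ys * c3 * ys^-1 * h3 * (ys * ytu).
  by rewrite !mulrA -(mulrA _ h3 ys) h3C !mulrA mulrVK.
by rewrite E4 !mulrA -(mulrA _ h3 c4) h3C !mulrA.
Qed.

(** The effect on a cocycle of the change of basis from z to y, the
    change-of-basis coefficients being y z^-1. *)
Lemma crossed_product_change (B : unitRingType) (ys yt yst zs zt zst h : B) :
    zs \is a GRing.unit -> zt \is a GRing.unit -> zst \is a GRing.unit ->
    yst \is a GRing.unit -> h \is a GRing.unit -> (forall b, h * b = b * h) ->
  ys * yt * yst^-1 * h^-1 =
  ys * zs^-1 * (zs * (yt * zt^-1) * zs^-1) * (zs * zt * zst^-1 * h^-1)
    * (yst * zst^-1)^-1.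
Proof.
move=> zsu ztu zstu ystu hu hC.
have hVC b : h^-1 * b = b * h^-1.
  by apply: (mulrI hu); rewrite mulVKr// mulrA hC mulrK.
rewrite invrM ?unitrV// invrK !mulrA !mulrVK// -(mulrA _ h^-1 zst) hVC.
by rewrite !mulrA mulrVK// -(mulrA _ h^-1) hVC mulrA.
Qed.

(** Two expressions of one product, cleared of the unit y, whose common left
    factor c cancels. *)
Lemma carry_cancel (B : unitRingType) (c c' d e e' h y w : B) :
    y \is a GRing.unit -> h \is a GRing.unit -> (forall b, e' * b = b * e') ->
    c' * c = 1 -> d = c * w -> c * e * (y * e') = d * h * y ->
  w = e * e' * h^-1.
Proof.
move=> yu hu eC cc -> E; apply: (mulIr hu); rewrite mulrVK//; apply: (mulIr yu).
rewrite -[LHS]mul1r -[RHS]mul1r -cc -!(mulrA c').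
by congr (_ * _); rewrite !mulrA -E -!mulrA eC.
Qed.

(** * Factor sets from systems of homogeneous units *)

(** What the computations below use of a graded division ring B with subring
    B0 of degree 0 elements: j is the inclusion, r a retraction onto B0, and
    dg f c says that f is a nonzero homogeneous element of degree c. *)
Record homogeneous_units (G : zmodType) (B B0 : unitRingType)
    (j : {rmorphism B0 -> B}) (r : B -> B0) (dg : B -> G -> Prop) : Prop :=
  HomogeneousUnits {
    degree0K : cancel j r;
    homogM : forall f h c d, dg f c -> dg h d -> dg (f * h) (c + d);
    homogV : forall f c, dg f c -> dg f^-1 (- c);
    homog_unit : forall f c, dg f c -> f \is a GRing.unit;
    homog_degree0 : forall f, dg f 0 -> exists a, f = j a;
    degree0_homog : forall a, a \is a GRing.unit -> dg (j a) 0;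
    homog_normal : forall f c a, dg f c -> exists b, f * j a * f^-1 = j b
  }.

Section HomogeneousSystems.
Variables (G : zmodType) (B B0 : unitRingType) (j : {rmorphism B0 -> B}).
Variables (r : B -> B0) (dg : B -> G -> Prop).
Hypothesis dgP : homogeneous_units j r dg.
Let jK := degree0K dgP.
Let dgM := homogM dgP.
Let dgV := homogV dgP.
Let dg_unit := homog_unit dgP.
Let dg0 := homog_degree0 dgP.
Let dgj := degree0_homog dgP.
Let dg_normal := homog_normal dgP.

Definition hconj (f : B) (a : B0) : B0 := r (f * j a * f^-1).

Lemma degree0_rK f : dg f 0 -> j (r f) = f.
Proof. by move=> /dg0[a ->]; rewrite jK. Qed.

Lemma hconjE f c a : dg f c -> j (hconj f a) = f * j a * f^-1.
Proof. by move=> fc; rewrite /hconj; have [b ->] := dg_normal a fc; rewrite jK. Qed.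

Lemma degree0_r_unit f : dg f 0 -> r f \is a GRing.unit.
Proof.
move=> f0; have [a fa] := dg0 f0; have [b fb] : exists b, f^-1 = j b.
  by apply: dg0; rewrite -oppr0; apply: dgV.
have fu := dg_unit f0.
apply/unitrP; exists b; rewrite fa jK; split; apply: (can_inj jK).
  by rewrite rmorphM rmorph1 -fa -fb mulVr.
by rewrite rmorphM rmorph1 -fa -fb mulrV.
Qed.

Lemma hconj_aut f c : dg f c -> ring_aut (hconj f).
Proof.
move=> fc; have fu := dg_unit fc; have fV := dgV fc; split.
- move=> a b; apply: (can_inj jK).
  by rewrite rmorphB !(hconjE _ fc) rmorphB mulrBr mulrBl.
- split=> [|a b]; apply: (can_inj jK); rewrite ?rmorphM !(hconjE _ fc).
    by rewrite rmorph1 mulr1 mulrV.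
  by rewrite rmorphM !mulrA mulrVK.
- exists (hconj f^-1) => a; apply: (can_inj jK).
    by rewrite (hconjE _ fV) (hconjE _ fc) invrK !mulrA mulVr// mul1r mulrVK.
  by rewrite (hconjE _ fc) (hconjE _ fV) invrK !mulrA mulrV// mul1r mulrK.
Qed.

Lemma hconjM f h c d a : dg f c -> dg h d -> hconj (f * h) a = hconj f (hconj h a).
Proof.
move=> fc hd; apply: (can_inj jK).
rewrite (hconjE _ (dgM fc hd)) (hconjE _ fc) (hconjE _ hd).
by rewrite invrM ?(dg_unit fc) ?(dg_unit hd)// !mulrA.
Qed.

Lemma hconj_commute f c a : dg f c -> f * j a = j a * f -> hconj f a = a.
Proof.
move=> fc fa; apply: (can_inj jK).
by rewrite (hconjE _ fc) fa mulrK// (dg_unit fc).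
Qed.

Lemma hconj_unit a b : a \is a GRing.unit -> hconj (j a) b = a * b * a^-1.
Proof.
move=> au; apply: (can_inj jK).
by rewrite (hconjE _ (dgj au)) !rmorphM rmorphV.
Qed.

(** On the center of B0, conjugation by f depends only on the degree of f
    modulo the degrees of central units: f = y b e with b in B0 and e central,
    and b acts trivially on the center of B0. *)
Lemma hconj_central_class f y e c d a : dg f c -> dg y d -> dg e (c - d) ->
  (forall h, e * h = h * e) -> ring_center B0 a -> hconj f a = hconj y a.
Proof.
move=> fc yd ecd eC aC.
have kd : dg (y^-1 * f * e^-1) 0.
  have := dgM (dgM (dgV yd) fc) (dgV ecd).
  by rewrite [- d + c]addrC subrr.
have bu := degree0_r_unit kd; have bd := dgj bu.
have -> : f = y * j (r (y^-1 * f * e^-1)) * e.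
  by rewrite (degree0_rK kd) !mulrA mulrVK ?(dg_unit ecd)// mulrV ?(dg_unit yd)// mul1r.
move: (r _) bu bd => b bu bd.
rewrite (hconjM _ (dgM yd bd) ecd) (hconjM _ yd bd) (hconj_commute ecd) ?eC//.
by rewrite (hconj_unit _ bu) -aC mulrK.
Qed.

(* hh is the carry: deg : H -> G is only a section of the degree map, and    *)
(* hh s t makes up for its failure to be additive.                           *)
Variables (H : zmodType) (R : set H) (deg : H -> G) (hh : H -> H -> B).
Hypothesis RD : forall s t, R s -> R t -> R (s + t).
Hypothesis hh_deg : forall s t, R s -> R t ->
  dg (hh s t) (deg s + deg t - deg (s + t)).
Hypothesis hh_central : forall s t f, hh s t * f = f * hh s t.
Hypothesis hh_cocycle : forall s t u, R s -> R t -> R u ->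
  hh s t * hh (s + t) u = hh t u * hh s (t + u).
Implicit Types (s t u : H) (y z : H -> B).

Definition homogeneous_system y := forall s, R s -> dg (y s) (deg s).

Definition system_cocycle y s t : B0 :=
  r (y s * y t * (y (s + t))^-1 * (hh s t)^-1).

Lemma system_cocycle_degree y s t : homogeneous_system y -> R s -> R t ->
  dg (y s * y t * (y (s + t))^-1 * (hh s t)^-1) 0.
Proof.
move=> yd Rs Rt; have := dgV (hh_deg Rs Rt).
have := dgV (yd _ (RD Rs Rt)).
have := dgM (yd _ Rs) (yd _ Rt) => d1 d2 d3.
by have := dgM (dgM d1 d2) d3; rewrite subrr.
Qed.

Lemma system_cocycleE y s t : homogeneous_system y -> R s -> R t ->
  y s * y t = j (system_cocycle y s t) * hh s t * y (s + t).
Proof.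
move=> yd Rs Rt; rewrite degree0_rK; last exact: system_cocycle_degree.
rewrite mulrVK ?(dg_unit (hh_deg Rs Rt))//.
by rewrite mulrVK ?(dg_unit (yd _ (RD Rs Rt))).
Qed.

Lemma system_cocycleC y s t : y s * y t = y t * y s -> hh s t = hh t s ->
  system_cocycle y s t = system_cocycle y t s.
Proof. by move=> yC hC; rewrite /system_cocycle yC hC [t + s]addrC. Qed.

Lemma system_cocycle_unit y s t : homogeneous_system y -> R s -> R t ->
  system_cocycle y s t \is a GRing.unit.
Proof. by move=> yd Rs Rt; apply/degree0_r_unit/system_cocycle_degree. Qed.

(** Conjugation by y_s y_t = c h y_(s+t) is conjugation by y_(s+t) followed by
    conjugation by c, the carry h being central. *)
Lemma system_action y s t a : homogeneous_system y -> R s -> R t ->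
  hconj (y s) (hconj (y t) a) =
  system_cocycle y s t * hconj (y (s + t)) a * (system_cocycle y s t)^-1.
Proof.
move=> yd Rs Rt; rewrite -(hconjM _ (yd s Rs) (yd t Rt)) system_cocycleE//.
have cu := system_cocycle_unit yd Rs Rt; have cd := dgj cu.
have hd := hh_deg Rs Rt; have sd := yd _ (RD Rs Rt).
rewrite (hconjM _ (dgM cd hd) sd) (hconjM _ cd hd).
rewrite (hconj_commute hd); last exact: hh_central.
exact: hconj_unit.
Qed.

Lemma system_cocycle_assoc y s t u : homogeneous_system y -> R s -> R t -> R u ->
  system_cocycle y s t * system_cocycle y (s + t) u =
  hconj (y s) (system_cocycle y t u) * system_cocycle y s (t + u).
Proof.
move=> yd Rs Rt Ru; have Rst := RD Rs Rt; have Rtu := RD Rt Ru.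
have E4 := system_cocycleE yd Rs Rtu; rewrite addrA in E4.
apply: (can_inj jK); rewrite !rmorphM (hconjE _ (yd s Rs)).
apply: (crossed_product_assoc _ _ _ _ (hh_cocycle Rs Rt Ru) (system_cocycleE yd Rs Rt)
          (system_cocycleE yd Rst Ru) (system_cocycleE yd Rt Ru) E4).
- exact: dg_unit (yd s Rs).
- exact: dg_unit (yd _ (RD Rst Ru)).
- exact: dg_unit (dgM (hh_deg Rs Rt) (hh_deg Rst Ru)).
- by move=> b; split; apply: hh_central.
Qed.

Lemma system_factor_set y (act : H -> B0 -> B0) : homogeneous_system y ->
  (forall s a, R s -> ring_center B0 a -> hconj (y s) a = act s a) ->
  factor_set R act (fun s => hconj (y s)) (system_cocycle y).
Proof.
move=> yd ya; split=> //.
- by move=> s /yd/hconj_aut.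
- by move=> s t; apply: system_cocycle_unit.
- by move=> s t a; apply: system_action.
- by move=> s t u; apply: system_cocycle_assoc.
Qed.

(** Two systems with the same degrees differ by the elements y_s z_s^-1 of
    degree 0, which form the cochain relating their factor sets. *)
Lemma system_cohomologous y z : homogeneous_system y -> homogeneous_system z ->
  cohomologous R (fun s => hconj (z s)) (system_cocycle z)
                 (fun s => hconj (y s)) (system_cocycle y).
Proof.
move=> yd zd.
have cd s : R s -> dg (y s * (z s)^-1) 0.
  by move=> Rs; rewrite -(subrr (deg s)); apply/dgM/dgV/zd/Rs/yd.
exists (fun s => r (y s * (z s)^-1)); split=> [s /cd/degree0_r_unit//|s a Rs|s t Rs Rt].
  rewrite -(hconj_unit _ (degree0_r_unit (cd s Rs))) (degree0_rK (cd s Rs)) -(hconjM _ (cd s Rs) (zd s Rs)).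
  by rewrite mulrVK// (dg_unit (zd _ Rs)).
have Rst := RD Rs Rt.
apply: (can_inj jK); rewrite !rmorphM (rmorphV j (degree0_r_unit (cd _ Rst))).
rewrite (hconjE _ (zd s Rs)) (degree0_rK (cd s Rs)) (degree0_rK (cd t Rt)) (degree0_rK (cd _ Rst)).
rewrite (degree0_rK (system_cocycle_degree yd Rs Rt)) (degree0_rK (system_cocycle_degree zd Rs Rt)).
apply: crossed_product_change (hh_central s t).
- exact: dg_unit (zd _ Rs).
- exact: dg_unit (zd _ Rt).
- exact: dg_unit (zd _ Rst).
- exact: dg_unit (yd _ Rst).
- exact: dg_unit (hh_deg Rs Rt).
Qed.

End HomogeneousSystems.

(** * The graded ring of a valued division ring *)

Section GradedDivision.
Variables (G : orderedZmodType) (A : unitRingType) (v : valuation G A).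
Hypothesis A_division : forall x : A, x != 0 -> x \is a GRing.unit.
Local Notation hom := Defs.hom.
Local Notation gr := (gr v).
Local Notation residue := (residue v).
Implicit Types (f h k : gr) (g : G) (x : A) (a b : residue).

Lemma filt_ge_val x : x \in filt_ge v (v x).
Proof. by rewrite inE lexx orbT. Qed.

Lemma hom_neq0 x : x != 0 -> hom v (v x) x != 0.
Proof.
move=> x0; apply/eqP => /(congr1 (fun f : gr => f (v x))).
rewrite gr0 homE /hom_fun eqxx filt_ge_val.
rewrite -(raddf0 (\pi_({quot (filt_gt v (v x))}))%qT) => /pi_gtE.
by rewrite subr0 inE (negPf x0) ltxx.
Qed.

Lemma has_degree_hom x : x != 0 -> has_degree (hom v (v x) x) (v x).
Proof.
move=> x0; split=> [|c /negPf cx]; first exact: hom_neq0.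
by rewrite homE /hom_fun cx raddf0.
Qed.

(** A nonzero class in the component of degree g is that of an element whose
    value is exactly g: larger values are killed in the quotient. *)
Lemma has_degreeP f g :
  has_degree f g -> exists x, [/\ x != 0, v x = g & f = hom v (v x) x].
Proof.
move=> [f0 fg]; have fE : f = hom v g (gr_lift f g).
  apply: gr_eqP => c; rewrite homE /hom_fun lift_ge andbT.
  have [->|/fg->] := eqVneq c g; first by case: (gr_liftP f).
  by rewrite raddf0.
have := lift_ge f g; set x := gr_lift f g in fE *.
rewrite inE; have [x0|x0] := eqVneq x 0.
  case/eqP: f0; rewrite fE x0; apply: gr_eqP => c.
  by rewrite gr0 homE /hom_fun if_same raddf0.
rewrite /= le_eqVlt => /predU1P[gx|gx]; first by exists x; rewrite -gx.
case/eqP: f0; rewrite fE; apply: gr_eqP => c; rewrite gr0 homE /hom_fun.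
case: ifP => [/andP[/eqP-> _]|_]; last by rewrite raddf0.
rewrite -(raddf0 (\pi_({quot (filt_gt v g)}))%qT).
by apply/pi_gtE; rewrite subr0 inE gx orbT.
Qed.

Lemma divisionM_neq0 x y : x != 0 -> y != 0 -> x * y != 0.
Proof.
move=> x0 y0; apply: contraNneq (y0) => xy0.
by rewrite -(mulKr (A_division x0) y) xy0 mulr0.
Qed.

Lemma divisionV_neq0 x : x != 0 -> x^-1 != 0.
Proof. by move=> /A_division xu; rewrite -unitrV in xu; apply: memPn xu; rewrite unitr0. Qed.

Lemma valV x : x != 0 -> v x^-1 = - v x.
Proof.
move=> x0; apply/eqP; rewrite -addr_eq0 -Defs.valM ?divisionV_neq0//.
by rewrite mulVr ?A_division// Defs.val1.
Qed.

Lemma has_degree1 : has_degree (1 : gr) 0.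
Proof. by rewrite -(hom1 v) -(Defs.val1 v); apply: has_degree_hom; apply: oner_neq0. Qed.

Lemma has_degreeM f h g1 g2 :
  has_degree f g1 -> has_degree h g2 -> has_degree (f * h) (g1 + g2).
Proof.
move=> /has_degreeP[x [x0 <- ->]] /has_degreeP[y [y0 <- ->]].
rewrite homM ?filt_ge_val// -Defs.valM//.
exact/has_degree_hom/divisionM_neq0.
Qed.

Lemma hom_unitV x : x != 0 ->
  hom v (v x) x \is a GRing.unit /\ (hom v (v x) x)^-1 = hom v (v x^-1) x^-1.
Proof.
move=> x0; have xu := A_division x0.
have l : hom v (v x^-1) x^-1 * hom v (v x) x = 1.
  by rewrite homM ?filt_ge_val// valV// addNr mulVr// hom1.
have r : hom v (v x) x * hom v (v x^-1) x^-1 = 1.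
  by rewrite homM ?filt_ge_val// valV// addrN mulrV// hom1.
have u : hom v (v x) x \is a GRing.unit by apply/unitrP; eexists; split; eauto.
by split=> //; apply: (mulrI u); rewrite mulrV.
Qed.

Lemma has_degree_unit f g : has_degree f g -> f \is a GRing.unit.
Proof. by move=> /has_degreeP[x [x0 _ ->]]; case: (hom_unitV x0). Qed.

Lemma has_degreeV f g : has_degree f g -> has_degree f^-1 (- g).
Proof.
move=> /has_degreeP[x [x0 <- ->]]; have [_ ->] := hom_unitV x0.
by rewrite -valV//; apply/has_degree_hom/divisionV_neq0.
Qed.

Lemma has_degreeX f g n : has_degree f g -> has_degree (f ^+ n) (g *+ n).
Proof.
move=> fg; elim: n => [|n IH]; first exact: has_degree1.
by rewrite exprS mulrS; apply: has_degreeM.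
Qed.

Lemma has_degree_prod (I : Type) (s : seq I) (F : I -> gr) (d : I -> G) :
  (forall i, has_degree (F i) (d i)) ->
  has_degree (\prod_(i <- s) F i) (\sum_(i <- s) d i).
Proof.
move=> Fd; apply: (big_ind2 (@has_degree _ _ v)) => //; first exact: has_degree1.
by move=> *; apply: has_degreeM.
Qed.

Lemma gr_resK f : f \in @degree0 _ _ v -> resval (gr_res f) = f.
Proof. by move=> f0; rewrite /gr_res val_insubd f0. Qed.

Lemma has_degree0 f : has_degree f 0 -> f \in @degree0 _ _ v.
Proof. by case=> _ f0; apply/asboolP. Qed.

(** The support of f must be respected by the representatives taken in S, so
    0 is chosen as the representative of a zero component. *)
Lemma gr_sub_lifts (S : set A) f : S 0 -> gr_sub v S f ->
  exists s F, lifts F s f /\ forall g, S (F g).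
Proof.
move=> S0 fS; have /choice[F FS] : forall g, exists x,
    [/\ S x, x \in filt_ge v g, f g = \pi_({quot (filt_gt v g)})%qT x & f g = 0 -> x = 0].
  move=> g; have [f0|/eqP f0] := eqVneq (f g) 0.
    by exists 0; split=> //; rewrite ?rpred0// f0 raddf0.
  have [x [xS xg fx]] := fS g; exists x; split=> //.
have [us us0 _ _] := gr_liftP f.
exists (gr_supp f), F; split=> [|g]; last by case: (FS g).
split=> // g; try by case: (FS g).
move/us0; have [_ _ _ fF] := FS g => l0; apply: fF.
by have [_ _ _ ->] := gr_liftP f; rewrite l0 raddf0.
Qed.

(** Products in the graded ring are convolutions of representatives, so
    commutation of representatives is enough. *)
Lemma gr_sub_comm (S T : set A) f h : S 0 -> T 0 ->
  (forall x y, S x -> T y -> x * y = y * x) ->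
  gr_sub v S f -> gr_sub v T h -> f * h = h * f.
Proof.
move=> S0 T0 ST /(gr_sub_lifts S0)[s [F [Ff FS]]] /(gr_sub_lifts T0)[t [H [Hh HT]]].
apply: gr_eqP => g; rewrite (gr_mulE g Ff Hh) (gr_mulE g Hh Ff); congr \pi%qT.
rewrite /conv (exchange_big_dep predT)//=; apply: eq_bigr => b _.
by apply: eq_big => [a|a _]; rewrite 1?addrC// ST.
Qed.

Lemma gr_subT f : gr_sub v setT f.
Proof.
move=> g; exists (gr_lift f g); split=> //; first exact: lift_ge.
by have [_ _ _ ->] := gr_liftP f.
Qed.

Lemma gr_subM (S : set A) f h : S 0 -> (forall x y, S x -> S y -> S (x + y)) ->
  (forall x y, S x -> S y -> S (x * y)) ->
  gr_sub v S f -> gr_sub v S h -> gr_sub v S (f * h).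
Proof.
move=> S0 SD SM /(gr_sub_lifts S0)[s [F [Ff FS]]] /(gr_sub_lifts S0)[t [H [Hh HS]]] g.
exists (conv s t F H g); split; last exact: gr_mulE.
- by apply: big_ind => // a _; apply: big_ind => // b _; apply: SM.
- by case: Ff Hh => [? ? ? ?] [? ? ? ?]; apply: conv_ge.
Qed.

Lemma gr_sub_hom (S : set A) g x : S 0 -> S x -> gr_sub v S (hom v g x).
Proof.
move=> S0 Sx c; exists (hom_fun v g x c); split=> //; last exact: hom_fun_ge.
by rewrite /hom_fun; case: ifP.
Qed.

Lemma gr_sub_degree0 (S : set A) f :
  f \in @degree0 _ _ v -> gr_sub v S f -> res_sub v S (gr_res f).
Proof.
move=> f0 /(_ 0)[x [Sx x0 fx]]; exists x; split=> //; apply: val_inj.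
rewrite /= gr_resK//; apply: gr_eqP => c; rewrite homE /hom_fun x0 andbT.
by case: eqP => [->|/eqP c0]; [rewrite fx|rewrite raddf0; move/asboolP: f0; apply].
Qed.

Lemma resval_gr_res : cancel (@resval _ _ v) (@gr_res _ _ v).
Proof. by move=> a; apply: val_inj; rewrite /= gr_resK ?resvalP. Qed.

Lemma has_degree0_resval f : has_degree f 0 -> exists a, f = resval a.
Proof. by move=> /has_degree0 f0; exists (gr_res f); rewrite gr_resK. Qed.

Lemma resval_degree a : a != 0 -> has_degree (resval a) 0.
Proof.
move=> a0; split=> [|c c0]; last by have /asboolP := resvalP a; apply.
by apply: contraNneq a0 => ra; apply/eqP/val_inj.
Qed.

Lemma resval_unit_degree a : a \is a GRing.unit -> has_degree (resval a) 0.
Proof. by move=> au; apply: resval_degree; apply: contraTneq au => ->; rewrite unitr0. Qed.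

(** This links the action [theta], defined by lifting to the valuation ring,
    with conjugation in the graded ring. *)
Lemma resval_res_conj x a : x != 0 ->
  resval (res v (x * res_lift a * x^-1)) =
  hom v (v x) x * resval a * (hom v (v x) x)^-1.
Proof.
move=> x0; have [_ ->] := hom_unitV x0.
rewrite [in RHS](degree0_homP (resvalP a)) -/(res_lift a).
rewrite homM ?filt_ge_val ?res_lift_ge// homM ?filt_ge_val//; last first.
  by rewrite filt_geM ?filt_ge_val ?res_lift_ge.
by rewrite addr0 valV// addrN.
Qed.

Lemma resval_normal f g a : has_degree f g -> exists b, f * resval a * f^-1 = resval b.
Proof. by move=> /has_degreeP[x [x0 _ ->]]; eexists; rewrite -resval_res_conj. Qed.

(** The inverse of a homogeneous element of degree 0 again has degree 0, so
    it too comes from the residue ring. *)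
Lemma gr_sub_unit_degree0 (S : set A) b : b != 0 ->
  units_of (gr_sub v S) (resval b) -> units_of (res_sub v S) b.
Proof.
move=> b0 [bS [f [fS bf fb]]]; have bd := resval_degree b0.
have bu := has_degree_unit bd.
have fE : f = (resval b)^-1 by apply: (mulrI bu); rewrite mulrV.
have [c fc] : exists c, f = resval c.
  by apply: has_degree0_resval; rewrite fE -oppr0; apply: has_degreeV.
rewrite fc in fS bf fb.
split; first by rewrite -(resval_gr_res b); apply: gr_sub_degree0; rewrite ?resvalP.
exists c; split; try exact: val_inj.
by rewrite -(resval_gr_res c); apply: gr_sub_degree0; rewrite ?resvalP.
Qed.

Lemma res_subM (S : set A) a b : (forall x y, S x -> S y -> S (x * y)) ->
  res_sub v S a -> res_sub v S b -> res_sub v S (a * b).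
Proof.
move=> SM [x [Sx x0 ->]] [y [Sy y0 ->]]; exists (x * y); rewrite resM//; split=> //.
  exact: SM.
by have := filt_geM x0 y0; rewrite addr0.
Qed.

Lemma res_sub1 (S : set A) : S 1 -> res_sub v S 1.
Proof.
move=> S1; exists 1; split=> //; last exact: val_inj.
by rewrite inE Defs.val1 lexx orbT.
Qed.

Lemma res_sub_central (S : set A) a b : (forall x y, S x -> x * y = y * x) ->
  res_sub v S a -> a * b = b * a.
Proof.
move=> SC [x [Sx x0 ->]]; rewrite -(res_liftK b).
by rewrite !resM ?res_lift_ge// SC.
Qed.

Lemma res_sub_gr (S : set A) a : S 0 -> res_sub v S a -> gr_sub v S (resval a).
Proof. by move=> S0 [x [Sx x0 ->]]; apply: gr_sub_hom. Qed.

End GradedDivision.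

(** * Units of a subring and their cosets *)

Section Units.
Variables (B : unitRingType) (S : set B).
Hypotheses (S1 : S 1) (SM : forall x y, S x -> S y -> S (x * y)).
Implicit Types x y : B.

Lemma units_of1 : units_of S 1.
Proof. by split=> //; exists 1; rewrite mulr1. Qed.

Lemma units_ofM x y : units_of S x -> units_of S y -> units_of S (x * y).
Proof.
move=> [Sx [x' [Sx' xx' x'x]]] [Sy [y' [Sy' yy' y'y]]]; split; first exact: SM.
exists (y' * x'); split; first exact: SM.
  by rewrite -mulrA (mulrA y) yy' mul1r.
by rewrite -mulrA (mulrA x') x'x mul1r.
Qed.

Lemma units_ofX x n : units_of S x -> units_of S (x ^+ n).
Proof.
move=> Sx; elim: n => [|n IH]; first exact: units_of1.
by rewrite exprS; apply: units_ofM.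
Qed.

Lemma units_of_unit x : units_of S x -> x \is a GRing.unit.
Proof. by move=> [_ [y [_ xy yx]]]; apply/unitrP; exists y. Qed.

Lemma units_ofV x : units_of S x -> units_of S x^-1.
Proof.
move=> Sx; have xu := units_of_unit Sx; case: Sx => Sx [y [Sy xy yx]].
have -> : x^-1 = y by apply: (mulrI xu); rewrite mulrV.
by split=> //; exists x.
Qed.

Lemma unit_coset_refl x : unit_coset S x x.
Proof. by exists x => //; exists 1; rewrite ?mulr1//; apply: units_of1. Qed.

Lemma unit_cosetP x y : unit_coset S x y <-> exists2 e, units_of S e & y = x * e.
Proof.
by split=> [[_ -> [e Se <-]]|[e Se ->]]; [exists e|exists x => //; exists e].
Qed.

Lemma unit_cosetMr x e : units_of S e -> unit_coset S (x * e) = unit_coset S x.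
Proof.
move=> Se; apply/seteqP; split=> y /unit_cosetP[f Sf ->]; apply/unit_cosetP.
  by exists (e * f); rewrite ?mulrA//; apply: units_ofM.
exists (e^-1 * f); first by apply: units_ofM => //; apply: units_ofV.
by rewrite -mulrA mulVKr// (units_of_unit Se).
Qed.

Lemma unit_cosetM x y : (forall e, S e -> e * y = y * e) ->
  set_mul (unit_coset S x) (unit_coset S y) = unit_coset S (x * y).
Proof.
move=> Sy; apply/seteqP; split=> z.
  move=> [_ /unit_cosetP[e Se ->] [_ /unit_cosetP[f Sf ->] <-]].
  apply/unit_cosetP; exists (e * f); first exact: units_ofM.
  by rewrite mulrA -(mulrA x e) (Sy _ (proj1 Se)) !mulrA.
move=> /unit_cosetP[e Se ->]; exists x; first exact: unit_coset_refl.
by exists (y * e); rewrite ?mulrA//; apply/unit_cosetP; exists e.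
Qed.

End Units.

(** * The graded base field and the action on the center of the residue ring *)

Section ValuedDivisionAlgebra.
Variables (G : orderedZmodType) (E : fieldType) (vE : valuation G E).
Variables (D : falgType E) (D_division : forall y : D, y != 0 -> y \is a GRing.unit).
Variables (vD : valuation G D) (vD_ext : forall a : E, a != 0 -> vD a%:A = vE a).
Local Notation hom := Defs.hom.
Local Notation gr := (gr vD).
Local Notation residue := (residue vD).
Local Notation Q := (value_quot vE).
Local Notation cls := (value_class vE).
Local Notation base := (base_field D).
Local Notation GE := (gr_sub vD base).
Local Notation Ebar := (res_sub vD base).
Local Notation resj := (\val : {rmorphism residue -> gr}).
Local Notation conj := (hconj resj (@gr_res _ _ vD)).

Lemma base1 : base 1. Proof. by exists 1; rewrite ?scale1r. Qed.
Lemma base0 : base 0. Proof. by exists 0; rewrite ?scale0r. Qed.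
Lemma baseD x y : base x -> base y -> base (x + y).
Proof. by move=> [a _ <-] [b _ <-]; exists (a + b); rewrite ?scalerDl. Qed.
Lemma baseM x y : base x -> base y -> base (x * y).
Proof. by move=> [a _ <-] [b _ <-]; exists (a * b); rewrite // -scalerAl mul1r scalerA. Qed.
Lemma base_central x y : base x -> x * y = y * x.
Proof. by move=> [a _ <-]; rewrite mulr_algl mulr_algr. Qed.

Lemma GE1 : GE 1. Proof. exact: gr_sub_hom base0 base1. Qed.
Lemma GEM f h : GE f -> GE h -> GE (f * h).
Proof. exact: gr_subM base0 baseD baseM. Qed.
Lemma GE_unitM f h : units_of GE f -> units_of GE h -> units_of GE (f * h).
Proof. exact: (@units_ofM _ GE GEM). Qed.
Lemma GE_unitX f n : units_of GE f -> units_of GE (f ^+ n).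
Proof. exact: (@units_ofX _ GE GE1 GEM). Qed.
Lemma GE_central f h : GE f -> f * h = h * f.
Proof.
move=> fE; apply: (gr_sub_comm base0 (T := setT)) fE (gr_subT _) => // x y xb _.
exact: base_central.
Qed.

Lemma value_classD g h : cls (g + h) = cls g + cls h.
Proof. exact: raddfD. Qed.

(** Degrees that agree modulo Gamma_E differ by the value of some a in E; the
    class of a is the unit of GE used to correct degrees. *)
Lemma GE_unit_of_degree g h : cls g = cls h ->
  exists e, units_of GE e /\ has_degree e (g - h).
Proof.
move=> /eqP; rewrite -Quotient.idealrBE => /asboolP[a [_ a0 va]].
have aA0 (b : E) : b != 0 -> b%:A != 0 :> D by rewrite scaler_eq0 oner_eq0 orbF.
exists (hom vD (vD a%:A) a%:A); split; last first.
  by rewrite -va -vD_ext//; apply/has_degree_hom/aA0.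
have [u V] := hom_unitV vD D_division (aA0 _ a0).
split; first by apply: gr_sub_hom base0 _; exists a.
exists (hom vD (vD a%:A) a%:A)^-1; rewrite mulVr// mulrV//; split=> //.
rewrite V; apply: gr_sub_hom base0 _; exists a^-1 => //.
apply: (mulrI (D_division (aA0 _ a0))); rewrite mulrV ?D_division ?aA0//.
by rewrite -scalerAl mul1r scalerA mulfV// scale1r.
Qed.

Lemma gr_homogeneous_units :
  homogeneous_units resj (@gr_res _ _ vD) (@has_degree _ _ vD).
Proof.
split.
- exact: resval_gr_res.
- exact: has_degreeM.
- exact: has_degreeV.
- exact: has_degree_unit.
- exact: has_degree0_resval.
- exact: resval_unit_degree.
- by move=> f c a fc; apply: resval_normal fc.
Qed.

Lemma conj_central_class f y g h a : has_degree f g -> has_degree y h ->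
  cls g = cls h -> ring_center residue a -> conj f a = conj y a.
Proof.
move=> fg yh /GE_unit_of_degree[e [eE ed]].
apply: (hconj_central_class gr_homogeneous_units fg yh ed).
by move=> k; apply: GE_central; case: eE.
Qed.

Lemma rel_value_groupD (S : set D) (s t : Q) :
  (forall x y, S x -> S y -> S (x * y)) ->
  rel_value_group vE vD S s -> rel_value_group vE vD S t ->
  rel_value_group vE vD S (s + t).
Proof.
move=> SM [g [x [Sx x0 <-]] <-] [h [y [Sy y0 <-]] <-].
exists (vD (x * y)); last by rewrite Defs.valM// value_classD.
by exists (x * y); split; [exact: SM|exact: divisionM_neq0|].
Qed.

(** [theta] is computed from an arbitrarily chosen x of the right class; on the
    center any homogeneous y of that class gives the same automorphism. *)
Lemma theta_conj s a y h : rel_value_group vE vD setT s ->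
  has_degree y h -> cls h = s -> ring_center residue a -> conj y a = theta s a.
Proof.
move=> [g [w [_ w0 wg]] gs] yh hs aC.
have [x0 xs] : [set x | x != 0 /\ cls (vD x) = s]
    (xget 1 [set x | x != 0 /\ cls (vD x) = s]).
  by apply: (xgetPex 1 (P := [set x | x != 0 /\ cls (vD x) = s])); exists w; rewrite /= w0 wg.
rewrite -(conj_central_class (has_degree_hom vD x0) yh _ aC) ?xs ?hs//.
by apply: val_inj; rewrite (hconjE gr_homogeneous_units _ (has_degree_hom vD x0)) -resval_res_conj.
Qed.

(** * Degrees and carries in the basis delta *)

Section Coordinates.
Variables (r : nat) (delta : 'I_r -> G) (q : 'I_r -> nat).
Hypothesis delta_basis : value_basis vE vD delta q.
Local Notation GammaDE := (rel_value_group vE vD setT).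
Local Notation crd := (coords (vE := vE) delta q).
Implicit Types s t u : Q.

Lemma value_class_sum (m : 'I_r -> nat) :
  cls (\sum_i delta i *+ m i) = \sum_i cls (delta i) *+ m i.
Proof.
rewrite [LHS](raddf_sum (\pi_({quot (field_value_group vE)}))%qT).
by apply: eq_bigr => i _; rewrite raddfMn.
Qed.

Lemma coordsP s : GammaDE s ->
  (forall i, crd s i < q i)%N /\ s = \sum_i cls (delta i) *+ crd s i.
Proof.
move=> Ds; case: delta_basis => _ _ /(_ s Ds)[m [mP _]].
by rewrite /coords; case: xgetP => [m' -> []|/(_ m) []].
Qed.

Lemma coords_unique s (m : {ffun 'I_r -> nat}) : GammaDE s ->
  (forall i, m i < q i)%N -> s = \sum_i cls (delta i) *+ m i -> crd s = m.
Proof.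
move=> Ds mq sm; case: delta_basis => _ _ /(_ s Ds)[m' [_ m'U]].
by rewrite -(m'U _ (coordsP Ds)) -(m'U m).
Qed.

(** Reducing the sum of the coordinates modulo q_i does not change the class,
    since q_i kills that of delta_i; uniqueness of coordinates concludes. *)
Lemma coordsD s t i : GammaDE s -> GammaDE t ->
  crd (s + t) i = ((crd s i + crd t i) %% q i)%N.
Proof.
move=> Ds Dt; have q0 k : (0 < q k)%N by case: delta_basis => _ /(_ k)[].
have qK k : cls (delta k) *+ q k = 0 by case: delta_basis => _ /(_ k)[].
have [_ sE] := coordsP Ds; have [_ tE] := coordsP Dt.
rewrite (@coords_unique _ [ffun k => ((crd s k + crd t k) %% q k)%N]) ?ffunE//.
- exact: rel_value_groupD.
- by move=> k; rewrite ffunE ltn_mod.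
rewrite {1}sE {1}tE -big_split; apply: eq_bigr => k _ /=.
rewrite ffunE -mulrnDr {1}(divn_eq (crd s k + crd t k) (q k)) mulrnDr.
by rewrite mulnC mulrnA qK mul0rn add0r.
Qed.

Definition coord_degree s : G := \sum_i delta i *+ crd s i.

Lemma coord_degree_class s : GammaDE s -> cls (coord_degree s) = s.
Proof. by move=> /coordsP[_ sE]; rewrite value_class_sum -sE. Qed.

Variables (x z : 'I_r -> gr).
Hypothesis x_unit : forall i, units_of GE (x i).
Hypothesis x_deg : forall i, has_degree (x i) (delta i *+ q i).
Hypothesis z_deg : forall i, has_degree (z i) (delta i).
Local Notation fh := (fs_h (vE := vE) delta q x).
Local Notation fz := (fs_z (vE := vE) delta q z).

Lemma fs_z_degree s : has_degree (fz s) (coord_degree s).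
Proof. by apply: has_degree_prod => // i; apply: has_degreeX. Qed.

Lemma fs_h_degree s t : GammaDE s -> GammaDE t ->
  has_degree (fh s t) (coord_degree s + coord_degree t - coord_degree (s + t)).
Proof.
move=> Ds Dt; rewrite /coord_degree -big_split -sumrB /=.
apply: has_degree_prod => // i.
have -> : delta i *+ crd s i + delta i *+ crd t i - delta i *+ crd (s + t) i =
          delta i *+ q i *+ ((crd s i + crd t i) %/ q i).
  rewrite coordsD// -mulrnDr {1}(divn_eq (crd s i + crd t i) (q i)) mulrnDr addrK.
  by rewrite mulnC mulrnA.
exact: has_degreeX.
Qed.

Lemma fs_h_unit s t : units_of GE (fh s t).
Proof.
rewrite /fs_h; apply: (big_ind (units_of GE)) => [|f h|i _].
- exact: units_of1 GE1.
- exact: GE_unitM.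
- exact: GE_unitX.
Qed.

Lemma fs_hC s t : fh s t = fh t s.
Proof. by apply: eq_bigr => i _; rewrite addnC. Qed.

(** The x_i are central in GD, so the product may be split factor by factor
    although GD is not commutative. *)
Lemma prod_xX (a b : 'I_r -> nat) :
  (\prod_i x i ^+ a i) * (\prod_i x i ^+ b i) = \prod_i x i ^+ (a i + b i).
Proof.
apply: (big_rec3 (fun f h k => f * h = k)) => [|i f h k _ <-]; first by rewrite mulr1.
have xC : f * x i ^+ b i = x i ^+ b i * f.
  by symmetry; apply: GE_central; case: (GE_unitX (b i) (x_unit i)).
by rewrite exprD -!mulrA (mulrA f) xC !mulrA.
Qed.

(** In each coordinate both exponents are the quotient by q_i of the sum of the
    three coordinates: carries may be taken in either order. *)
Lemma fs_h_cocycle s t u : GammaDE s -> GammaDE t -> GammaDE u ->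
  fh s t * fh (s + t) u = fh t u * fh s (t + u).
Proof.
move=> Ds Dt Du; rewrite !prod_xX; apply: eq_bigr => i _.
have q0 : (0 < q i)%N by case: delta_basis => _ /(_ i)[].
rewrite !coordsD//; congr (_ ^+ _).
set a := crd s i; set b := crd t i; set c := crd u i.
rewrite -divnMDl// -divnMDl// addnA -divn_eq.
by rewrite addnCA -divn_eq addnA.
Qed.

(** * Restriction to the value group of a Kummer subfield *)

Section Subfield.
Variable K : set D.
Hypothesis base_sub : forall w, base w -> K w.
Hypothesis KD : forall v w, K v -> K w -> K (v + w).
Hypothesis KM : forall v w, K v -> K w -> K (v * w).
Hypothesis KC : forall v w, K v -> K w -> v * w = w * v.
Local Notation GK := (gr_sub vD K).
Local Notation Kbar := (res_sub vD K).
Local Notation GammaKE := (rel_value_group vE vD K).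
Local Notation resKUM := (res_KUM vD K).
Variable alpha : Q -> Q -> set residue.
Hypothesis alphaP : represents_kum_extension vE vD K alpha.

Lemma K0 : K 0. Proof. exact/base_sub/base0. Qed.
Lemma GE_sub f : GE f -> GK f.
Proof. by move=> fE g; have [w [/base_sub wK ? ?]] := fE g; exists w. Qed.
Lemma GKM f h : GK f -> GK h -> GK (f * h). Proof. exact: gr_subM K0 KD KM. Qed.
Lemma GK_comm f h : GK f -> GK h -> f * h = h * f.
Proof. exact: gr_sub_comm K0 K0 KC. Qed.
Lemma GammaKE_D s t : GammaKE s -> GammaKE t -> GammaKE (s + t).
Proof. exact: rel_value_groupD. Qed.
Lemma GammaKE_sub s : GammaKE s -> GammaDE s.
Proof. by move=> [g [w [_ w0 <-]] <-]; exists (vD w) => //; exists w. Qed.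

Lemma Ebar1 : Ebar 1. Proof. exact: res_sub1 base1. Qed.
Lemma EbarM a b : Ebar a -> Ebar b -> Ebar (a * b).
Proof. exact: res_subM baseM. Qed.
Lemma Ebar_central a b : Ebar a -> a * b = b * a.
Proof. by apply: res_sub_central => v w; apply: base_central. Qed.
Lemma Ebar_sub a : Ebar a -> Kbar a.
Proof. by move=> [w [/base_sub wK ? ?]]; exists w. Qed.
Lemma KbarM a b : Kbar a -> Kbar b -> Kbar (a * b).
Proof. exact: res_subM KM. Qed.
Lemma Ebar_unitM a b : units_of Ebar a -> units_of Ebar b -> units_of Ebar (a * b).
Proof. exact: (@units_ofM _ Ebar EbarM). Qed.

Lemma Ebar_unit_sub a : units_of Ebar a -> units_of Kbar a.
Proof.
by move=> [aE [b [bE ab ba]]]; split; [|exists b; split=> //]; exact: Ebar_sub.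
Qed.

Lemma res_KUM_unit a : resKUM a -> a \is a GRing.unit.
Proof. by move=> [aK _]; exact: units_of_unit aK. Qed.

Lemma res_KUM_sub a : resKUM a -> Kbar a.
Proof. by move=> [[]]. Qed.

(** The m-th power of a e is a^m e^m because the residue field of E is
    central. *)
Lemma res_KUM_Ebar a e : resKUM a -> units_of Ebar e -> resKUM (a * e).
Proof.
move=> [aK am] eE; split.
  exact: (@units_ofM _ Kbar KbarM _ _ aK (Ebar_unit_sub eE)).
have eC : GRing.comm a e by rewrite /GRing.comm (Ebar_central a (proj1 eE)).
rewrite exprMn_comm//; apply: EbarM => //.
by case: (@units_ofX _ Ebar Ebar1 EbarM _ (aut_exponent Kbar (rel_aut Ebar Kbar)) eE).
Qed.

Lemma res_KUM1 : resKUM 1.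
Proof.
split; last by rewrite expr1n; exact: Ebar1.
exact: (Ebar_unit_sub (@units_of1 _ Ebar Ebar1)).
Qed.

(** Each coset U s contains a homogeneous k whose degree g is congruent to
    that of z_s; multiplying k by a unit of GE makes the degrees equal and
    leaves the coset unchanged. *)
Lemma kummer_system (U : Q -> set gr) :
  (forall s, GammaKE s -> gr_kum K (U s) /\ kum_psi (U s) s) ->
  exists y : Q -> gr, forall s, GammaKE s ->
    [/\ has_degree (y s) (coord_degree s), GK (y s) & U s = unit_coset GE (y s)].
Proof.
move=> uP; suff /choice[y yP] : forall s, exists y, GammaKE s ->
    [/\ has_degree y (coord_degree s), GK y & U s = unit_coset GE y] by exists y.
move=> s; have [Ks|nKs] := pselect (GammaKE s); last by exists 0.
have [[f [fu _] us] [k [g [kus kg gs]]]] := uP s Ks.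
have /GE_unit_of_degree[e [eE ed]] : cls (coord_degree s) = cls g.
  by rewrite gs; exact: coord_degree_class (GammaKE_sub Ks).
have /(@unit_cosetP _ GE)[e' e'E ke'] : unit_coset GE f k by rewrite us.
exists (f * (e' * e)); split.
- rewrite mulrA -ke' (_ : coord_degree s = g + (coord_degree s - g)); last by rewrite addrC subrK.
  exact: has_degreeM.
- by apply: GKM (proj1 fu) (GE_sub (proj1 (GE_unitM e'E eE))).
- by rewrite -us (@unit_cosetMr _ GE GEM)//; apply: GE_unitM.
Qed.

Local Notation omega := (fs_omega (vE := vE) delta q z).
Local Notation d := (fs_d (vE := vE) delta q x z).
Local Notation cocyc := (system_cocycle (@gr_res _ _ vD) fh).

Lemma fs_h_central s t f : fh s t * f = f * fh s t.
Proof. exact: GE_central (proj1 (fs_h_unit s t)). Qed.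

Lemma fs_h_degreeK s t : GammaKE s -> GammaKE t ->
  has_degree (fh s t) (coord_degree s + coord_degree t - coord_degree (s + t)).
Proof. by move=> /GammaKE_sub Ds /GammaKE_sub; apply: fs_h_degree. Qed.

Section KummerSystem.
Variables (U : Q -> set gr) (y : Q -> gr).
Hypothesis yP : forall s, GammaKE s ->
  [/\ has_degree (y s) (coord_degree s), GK (y s) & U s = unit_coset GE (y s)].

Lemma kummer_system_homogeneous : homogeneous_system (@has_degree _ _ vD) GammaKE coord_degree y.
Proof. by move=> s /yP[]. Qed.

(** The coset of y_s y_t is that of phi(alpha(s,t)) y_(s+t), so d'(s,t) is an
    element of alpha(s,t) times a unit of GE. That unit has degree 0, like the
    two elements that it relates, and hence lies in the residue field of E. *)
Lemma system_cocycle_kum s t : GammaKE s -> GammaKE t -> res_kum K (alpha s t) ->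
    set_mul (U s) (U t) = set_mul (kum_phi (alpha s t)) (U (s + t)) ->
  exists a e, [/\ resKUM a, units_of Ebar e, cocyc y s t = a * e
                & alpha s t = unit_coset Ebar a].
Proof.
move=> Ks Kt [a aKUM aE] UE; have Kst := GammaKE_D Ks Kt.
have ud : (y s * y t) \in set_mul (U s) (U t).
  apply/mem_set; have [_ _ ->] := yP Ks; have [_ _ ->] := yP Kt.
  exists (y s); first exact: (@unit_coset_refl _ GE GE1).
  by exists (y t) => //; apply: (@unit_coset_refl _ GE GE1).
move: ud; rewrite UE inE -aE => -[_ [_ [b ab <-] [e eE <-]]].
have [_ _ ->] := yP Kst => -[_ /(@unit_cosetP _ GE)[e' e'E ->]].
move/(@unit_cosetP _ Ebar): ab => [c cE ->] yE.
have acU : a * c \is a GRing.unit.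
  by rewrite (unitrMl _ (units_of_unit cE)); apply: res_KUM_unit aKUM.
have dE := system_cocycleE gr_homogeneous_units GammaKE_D fs_h_degreeK kummer_system_homogeneous Ks Kt.
have dU := system_cocycle_unit gr_homogeneous_units GammaKE_D fs_h_degreeK kummer_system_homogeneous Ks Kt.
(* e2 is e e' h^-1, seen in the residue ring. *)
pose e2 := (a * c)^-1 * cocyc y s t.
have e2U : e2 \is a GRing.unit by rewrite (unitrMl _ dU) unitrV.
have e2E : units_of Ebar e2.
  apply: (gr_sub_unit_degree0 D_division).
    by apply: contraTneq e2U => ->; rewrite unitr0.
  have -> : resval e2 = e * e' * (fh s t)^-1.
    apply: (carry_cancel (c' := resval (a * c)^-1) _ _ _ _ _ (etrans yE dE)).
    - exact: has_degree_unit (kummer_system_homogeneous Kst).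
    - exact: units_of_unit (fs_h_unit s t).
    - by move=> b'; apply: GE_central (proj1 e'E).
    - by rewrite -[LHS]/(resval ((a * c)^-1 * (a * c))) mulVr.
    - by rewrite -[RHS]/(resval (a * c * e2)) /e2 mulVKr.
  apply: GE_unitM; first exact: GE_unitM.
  exact: units_ofV (fs_h_unit s t).
exists a, (c * e2); split=> //; first exact: Ebar_unitM.
by rewrite mulrA /e2 mulVKr.
Qed.

End KummerSystem.

Lemma kummer_restriction :
  exists (d' : Q -> Q -> residue) (omega' : Q -> residue -> residue),
    [/\ sym_cocycle GammaKE resKUM d',
        forall s, GammaKE s -> forall a, Kbar a -> omega' s a = a,
        factor_set GammaKE theta omega' d',
        cohomologous GammaKE omega d omega' d'
      & kum_cohomologous vE vD K (fun s t => kum_class (d' s t)) alpha].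
Proof.
have [U [UP alpha_kum UE]] := alphaP; have [y yP] := kummer_system UP.
have yS := kummer_system_homogeneous yP.
have hc s t u : GammaKE s -> GammaKE t -> GammaKE u ->
    fh s t * fh (s + t) u = fh t u * fh s (t + u).
  by move=> /GammaKE_sub Ds /GammaKE_sub Dt /GammaKE_sub; apply: fs_h_cocycle.
have dP s t Ks Kt := system_cocycle_kum yP Ks Kt (alpha_kum s t Ks Kt) (UE s t Ks Kt).
have dK s t : GammaKE s -> GammaKE t -> resKUM (cocyc y s t).
  by move=> Ks Kt; have [a [e [aK eE -> _]]] := dP s t Ks Kt; apply: res_KUM_Ebar.
have yK s a : GammaKE s -> Kbar a -> conj (y s) a = a.
  move=> Ks aK; apply: (hconj_commute gr_homogeneous_units (yS s Ks)).
  by apply: GK_comm; [case: (yP s Ks)|apply: res_sub_gr aK; exact: K0].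
exists (cocyc y), (fun s => conj (y s)); split; [..|].
- split=> [|s t Ks Kt|s t u Ks Kt Ku]; first exact: dK.
    apply: system_cocycleC (fs_hC s t).
    by apply: GK_comm; [case: (yP s Ks)|case: (yP t Kt)].
  apply: (etrans (system_cocycle_assoc gr_homogeneous_units GammaKE_D fs_h_degreeK
                    fs_h_central hc yS Ks Kt Ku)).
  by move: (yK s _ Ks (res_KUM_sub (dK t u Kt Ku))) => ->.
- by move=> s Ks a; apply: yK.
- apply: (system_factor_set gr_homogeneous_units GammaKE_D fs_h_degreeK fs_h_central hc yS).
  move=> s a Ks; have Ds := GammaKE_sub Ks.
  exact: theta_conj (yS s Ks) (coord_degree_class Ds).
- apply: (system_cohomologous gr_homogeneous_units GammaKE_D fs_h_degreeK fs_h_central yS).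
  by move=> s _; apply: fs_z_degree.
(* d' reduces to alpha on the nose, so the trivial cochain relates them. *)
exists (fun=> kum_class 1); split=> [s _|s t Ks Kt].
  by exists 1 => //; apply: res_KUM1.
have cosetM b c :
    set_mul (unit_coset Ebar b) (unit_coset Ebar c) = unit_coset Ebar (b * c).
  by apply: (@unit_cosetM _ Ebar Ebar1 EbarM) => e; apply: Ebar_central.
have [a [e [aK eE -> ->]]] := dP s t Ks Kt.
rewrite /kum_class !cosetM !mulr1 mul1r.
exact: (@unit_cosetMr _ Ebar EbarM).
Qed.

End Subfield.

End Coordinates.

End ValuedDivisionAlgebra.

Theorem corollary2p11
    (G : orderedZmodType)
    (E : fieldType) (vE : valuation G E) (E_henselian : henselian vE)
    (D : falgType E) (D_division : forall y : D, y != 0 -> y \is a GRing.unit)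
    (D_central : 'Z({:D})%VS = 1%VS)
    (vD : valuation G D) (vD_ext : forall a : E, a != 0 -> vD a%:A = vE a)
    (D_tame : tame vE vD)
    (deg : nat) (degE : \dim {:D} = (deg ^ 2)%N)
    (char_deg : forall p : nat, p \in [pchar (residue vE)] -> ~~ (p %| deg)%N)
    (r : nat) (delta : 'I_r -> G) (q : 'I_r -> nat)
    (delta_basis : value_basis vE vD delta q)
    (x z : 'I_r -> gr vD)
    (x_unit : forall i, units_of (gr_sub vD (base_field D)) (x i))
    (x_deg : forall i, has_degree (x i) (delta i *+ q i))
    (z_unit : forall i, z i \is a GRing.unit)
    (z_deg : forall i, has_degree (z i) (delta i))
    (L : splittingFieldType E) (iota : {lrmorphism L -> D})
    (L_kummer : kummer_ext L)
    (alpha : value_quot vE -> value_quot vE -> set (residue vD))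
    (alphaP : represents_kum_extension vE vD (range iota) alpha) :
  let K := range iota in
  let GammaKE := rel_value_group vE vD K in
  let omega := fs_omega (vE := vE) delta q z in
  let d := fs_d (vE := vE) delta q x z in
  exists (d' : value_quot vE -> value_quot vE -> residue vD)
         (omega' : value_quot vE -> residue vD -> residue vD),
    [/\ sym_cocycle GammaKE (res_KUM vD K) d',
        forall s, GammaKE s -> forall a, res_sub vD K a -> omega' s a = a,
        factor_set GammaKE theta omega' d',
        cohomologous GammaKE omega d omega' d'
      & kum_cohomologous vE vD K (fun s t => kum_class (d' s t)) alpha].
Proof.
move=> K GammaKE omega d.
apply: (kummer_restriction D_division vD_ext delta_basis x_unit x_deg z_deg _ _ _ _ alphaP).
- by move=> _ [a _ <-]; exists a%:A => //; rewrite linearZ rmorph1.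
- by move=> _ _ [a _ <-] [b _ <-]; exists (a + b) => //; rewrite rmorphD.
- by move=> _ _ [a _ <-] [b _ <-]; exists (a * b) => //; rewrite rmorphM.
- by move=> _ _ [a _ <-] [b _ <-]; rewrite -!rmorphM mulrC.
Qed.
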